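(* Let $\Omega\subset\mathbb{R}^n$, $n\ge 2$, be open, let $v,f:\Omega\to\mathbb{R}$ with $f\in L^\infty_{loc}(\Omega)$, and assume that $v\in C^{1,1}(\Omega)$ satisfies $\Delta v=f$ a.e. in $\Omega$. Then $$(A_\varepsilon-I)[v](x)=\int_0^\varepsilon A_r[f](x)\,K_\varepsilon(r)\,dr$$ for all $x\in\Omega$ and every $0<\varepsilon<\mathrm{dist}(x,\partial\Omega)$. Alternatively, for almost every $x\in\Omega$ and every $0<\varepsilon<\mathrm{dist}(x,\partial\Omega)$, $$(A_\varepsilon-I)[v](x)=\frac{f(x)}{2(n+2)}\,\varepsilon^2+R_\varepsilon(x),\qquad (\ast)$$ where $$R_\varepsilon(x)=\int_0^\varepsilon A_r\big[f(\cdot)-f(x)\big](x)\,K_\varepsilon(r)\,dr=\int_0^\varepsilon \left(\frac{1}{|B_r(x)|}\int_{B_r(x)}\big(f(y)-f(x)\big)\,dy\right)K_\varepsilon(r)\,dr .$$ In particular: (1) If $f$ is continuous at $x$, then $R_\varepsilon(x)=o(\varepsilon^2)$ as $\varepsilon\to0$. If $f\in C(\Omega)$, then $(\ast)$ holds for every $x\in\Omega$ (and every $0<\varepsilon<\mathrm{dist}(x,\partial\Omega)$), and $R_\varepsilon=o(\varepsilon^2)$ as $\varepsilon\to 0$ locally uniformly in $\Omega$. (2) If $f$ has modulus of continuity $\omega$, i.e. $|f(x)-f(y)|\le\omega(|x-y|)$ for all $x,y\in\Omega$, where $\omega:[0,\infty)\to[0,\infty)$ is non-decreasing with $\lim_{t\to0^+}\omega(t)=0$,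 then $$|R_\varepsilon(x)|\le\frac{1}{2(n+2)}\,\omega(\varepsilon)\,\varepsilon^2\quad\text{for every }0<\varepsilon<\mathrm{dist}(x,\partial\Omega).$$ (3) If $f$ is Hölder or Lipschitz continuous in $\Omega$ with exponent $\alpha\in(0,1]$, then $R_\varepsilon=O(\varepsilon^{2+\alpha})$, i.e. there is a constant $C$ with $|R_\varepsilon(x)|\le C\varepsilon^{2+\alpha}$ for all $x\in\Omega$ and $0<\varepsilon<\mathrm{dist}(x,\partial\Omega)$.
   Context: $A_r[g](x)=\frac{1}{|B_r(x)|}\int_{B_r(x)}g(y)\,dy$ is the ball average and $I$ is the identity operator. In $A_r[f(\cdot)-f(x)](x)$ the number $f(x)$ is a constant with respect to the averaging variable. The kernel is $K_\varepsilon(r)=\frac{r}{n}\big(1-(r/\varepsilon)^n\big)$ for $0\le r\le\varepsilon$. $C^{1,1}(\Omega)$ denotes the $C^1(\Omega)$ functions whose first-order partial derivatives are locally Lipschitz in $\Omega$; second derivatives then exist a.e. and are locally bounded. If $\Omega=\mathbb{R}^n$, $\mathrm{dist}(x,\partial\Omega)=+\infty$. ''$R_\varepsilon=o(\varepsilon^k)$ as $\varepsilon\to0$ locally uniformly in $\Omega$'' means: for every compact $K\subset\Omega$ and every $\eta>0$ there is $\varepsilon_0>0$ such that $\operatorname{ess\,sup}_{x\in K}|R_\varepsilon(x)|\le\eta\,\varepsilon^k$ for all $0<\varepsilon<\varepsilon_0$. *)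

(* Defs.v *)
From HB Require Import structures.
From mathcomp Require Import all_boot all_order all_algebra.
From mathcomp Require Import all_classical all_reals all_analysis.
From mathcomp Require Import ess_sup_inf.

Set Implicit Arguments.
Unset Strict Implicit.
Unset Printing Implicit Defensive.

Import Order.TTheory GRing.Theory Num.Theory.
Import numFieldNormedType.Exports.

Local Open Scope classical_set_scope.
Local Open Scope ring_scope.

Definition rV_display : measure_display.
Proof. exact: default_measure_display. Qed.

Section rV_measurable.
Context {R : realType} (n : nat).

Let coord : 'I_n -> 'rV[R]_n -> measurableTypeR R := fun i x => x ord0 i.

(* The sigma-algebra generated by the coordinates is the Borel one; the
   Lebesgue sigma-algebra is carried by the Caratheodory type underlying
   [lebesgue_rV] below. *)
HB.instance Definition _ := @isMeasurable.Build rV_display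
  'rV[R]_n (g_sigma_preimage coord) (@sigma_algebra0 _ setT _)
  (@sigma_algebraC _ _) (@sigma_algebra_bigcup _ setT _).

Lemma measurable_rV_coord (i : 'I_n) :
  measurable_fun setT (fun x : 'rV[R]_n => x ord0 i : measurableTypeR R).
Proof.
move=> _ Y mY; rewrite setTI; apply: sub_sigma_algebra => /=.
rewrite -bigcup_seq/=; exists i => /=; first by rewrite mem_index_enum.
by exists Y => //; rewrite setTI.
Qed.

Lemma measurable_fun_rV d (T : measurableType d) (f : T -> 'rV[R]_n) :
  (forall i, measurable_fun setT (fun x => f x ord0 i : measurableTypeR R)) ->
  measurable_fun setT f.
Proof.
move=> mf; apply: (@measurability _ _ T 'rV[R]_n _ _
  (\big[setU/set0]_(i < n) preimage_set_system setT (coord i) measurable)) => //.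
move=> _ [B + <-]; rewrite -bigcup_seq => -[i _ [C mC <-]].
by rewrite setTI; exact: mf.
Qed.

End rV_measurable.

Section borel_lebesgue_rV.
Context {R : realType}.

Definition rV_cons n (p : measurableTypeR R * 'rV[R]_n) : 'rV[R]_n.+1 :=
  row_mx (p.1 : R)%:M p.2.

Definition rV_uncons n (x : 'rV[R]_n.+1) : measurableTypeR R * 'rV[R]_n :=
  (x ord0 ord0, \row_j x ord0 (lift ord0 j)).

Lemma rV_cons0 n p : rV_cons p ord0 (ord0 : 'I_n.+1) = p.1.
Proof.
have -> : ord0 = @lshift 1 n ord0 by exact: val_inj.
apply: (etrans (@row_mxEl R 1 1 n p.1%:M p.2 ord0 ord0)).
by rewrite mxE eqxx mulr1n.
Qed.

Lemma rV_consS n p (j : 'I_n) : rV_cons p ord0 (lift ord0 j) = p.2 ord0 j.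
Proof.
have -> : lift ord0 j = @rshift 1 n j by exact: val_inj.
exact: (@row_mxEr R 1 1 n p.1%:M p.2 ord0 j).
Qed.

Lemma rV_consK n : cancel (@rV_cons n) (@rV_uncons n).
Proof.
move=> [a x]; rewrite /rV_uncons rV_cons0; congr pair.
by apply/rowP => j; rewrite mxE rV_consS.
Qed.

Lemma measurable_rV_cons n : measurable_fun setT (@rV_cons n).
Proof.
apply: measurable_fun_rV => i; have [j ->|->] := unliftP ord0 i.
- under eq_fun do rewrite rV_consS.
  exact: (measurableT_comp (measurable_rV_coord j) measurable_snd).
- by under eq_fun do rewrite rV_cons0; exact: measurable_fst.
Qed.

Lemma measurable_rV_uncons n : measurable_fun setT (@rV_uncons n).
Proof.
apply/measurable_fun_pair; first exact: measurable_rV_coord.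
apply: measurable_fun_rV => i; under eq_fun do rewrite mxE.
exact: measurable_rV_coord.
Qed.

Section step.
Context n (mu : {sigma_finite_measure set 'rV[R]_n -> \bar R}).

Definition lebesgue_rVS : set 'rV[R]_n.+1 -> \bar R :=
  pushforward (@lebesgue_measure R \x mu)%E (@rV_cons n).

Let lebesgue_rVS0 : lebesgue_rVS set0 = 0%E.
Proof. by rewrite /lebesgue_rVS /pushforward preimage_set0 measure0. Qed.

Let lebesgue_rVS_ge0 A : (0 <= lebesgue_rVS A)%E.
Proof. by rewrite /lebesgue_rVS /pushforward measure_ge0. Qed.

Let lebesgue_rVS_sigma_additive : semi_sigma_additive lebesgue_rVS.
Proof.
move=> F mF tF mUF; rewrite /lebesgue_rVS /pushforward preimage_bigcup.
have mpre A : measurable A -> measurable (@rV_cons n @^-1` A).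
  by move=> mA; rewrite -[X in measurable X]setTI; exact: measurable_rV_cons.
apply: measure_semi_sigma_additive => //.
- by move=> k; exact: mpre.
- apply/trivIsetP => /= i j _ _ ij; rewrite -preimage_setI.
  by move/trivIsetP : tF => /(_ _ _ _ _ ij) ->//; rewrite preimage_set0.
- by rewrite -preimage_bigcup; exact: mpre.
Qed.

HB.instance Definition _ := isMeasure.Build _ _ _ lebesgue_rVS
  lebesgue_rVS0 lebesgue_rVS_ge0 lebesgue_rVS_sigma_additive.

Let lebesgue_rVS_sigma_finite : sigma_finite setT lebesgue_rVS.
Proof.
have /sigma_finiteP[F [TF ndF Foo]] := sigma_finiteT (@lebesgue_measure R).
have /sigma_finiteP[G [TG ndG Goo]] := sigma_finiteT mu.
exists (fun k => @rV_uncons n @^-1` (F k `*` G k)).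
  rewrite -preimage_bigcup -[LHS](@preimage_setT _ _ (@rV_uncons n)).
  congr (_ @^-1` _); apply/seteqP; split=> [[x y] _|//].
  have [k _ Fx] : (\bigcup_k F k) x by rewrite -TF.
  have [l _ Gy] : (\bigcup_k G k) y by rewrite -TG.
  exists (maxn k l) => //; split => /=.
    by move: x Fx; exact/subsetPset/ndF/leq_maxl.
  by move: y Gy; exact/subsetPset/ndG/leq_maxr.
move=> k; have [mF Fk] := Foo k; have [mG Gk] := Goo k; split.
  rewrite -[X in measurable X]setTI; apply: measurable_rV_uncons => //.
  exact: measurableX.
rewrite /lebesgue_rVS /pushforward -comp_preimage.
rewrite (_ : _ \o _ = id); last by apply/funext => p /=; rewrite rV_consK.
by rewrite preimage_id product_measure1E// lte_mul_pinfty// ge0_fin_numE.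
Qed.

HB.instance Definition _ := Measure_isSigmaFinite.Build _ _ _ lebesgue_rVS
  lebesgue_rVS_sigma_finite.

End step.

Fixpoint borel_lebesgue_rV n : {sigma_finite_measure set 'rV[R]_n -> \bar R} :=
  if n is m.+1 then lebesgue_rVS (borel_lebesgue_rV m)
  else \d_(0 : 'rV[R]_0).

End borel_lebesgue_rV.

(* Lebesgue measure on R^n, on the sigma-algebra of Lebesgue measurable sets. *)
Definition lebesgue_rV (R : realType) (n : nat) :=
  @completed_measure_extension _ _ _ (@borel_lebesgue_rV R n).
Arguments lebesgue_rV : clear implicits.

HB.instance Definition _ (R : realType) (n : nat) :=
  Measure.on (lebesgue_rV R n).

Section euclidean.
Context {R : realType} {n : nat}.
Implicit Types (x y : 'rV[R]_n) (A : set 'rV[R]_n).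

(* The library norm on ['rV_n] is the sup norm; the topology is the same. *)
Definition enorm x : R := Num.sqrt (\sum_(i < n) x ord0 i ^+ 2).

Definition eball x (r : R) : set 'rV[R]_n := [set y | enorm (y - x) < r].

Definition bdry A : set 'rV[R]_n := closure A `\` A°.

(* This is +oo when [A] is empty. *)
Definition set_dist x A : \bar R := ereal_inf [set (enorm (x - y))%:E | y in A].

End euclidean.

(* Functions on an open set Omega are total functions whose values outside of
   Omega are irrelevant: continuity and derivatives at a point of Omega only
   depend on values in Omega. *)
Section function_classes.
Context {R : realType} {n : nat}.
Implicit Types (Omega K : set 'rV[R]_n) (g v f : 'rV[R]_n -> R) (i : 'I_n).

Definition partial i g : 'rV[R]_n -> R := 'D_(delta_mx ord0 i) g.

Definition has_partial i g (x : 'rV[R]_n) := derivable g x (delta_mx ord0 i).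

Definition continuous_in Omega g := forall x, Omega x -> {for x, continuous g}.

Definition C1 Omega g :=
  continuous_in Omega g /\
  forall i, (forall x, Omega x -> has_partial i g x) /\
            continuous_in Omega (partial i g).

Definition locally_lipschitz Omega g := forall x, Omega x ->
  exists r L : R, 0 < r /\
    forall y z, Omega y -> Omega z -> eball x r y -> eball x r z ->
      `|g y - g z| <= L * enorm (y - z).

Definition C11 Omega g :=
  C1 Omega g /\ forall i, locally_lipschitz Omega (partial i g).

(* Only meaningful where the pure second derivatives exist, since ['D_] is
   total. *)
Definition laplacian v (x : 'rV[R]_n) : R := \sum_(i < n) partial i (partial i v) x.

Definition poisson_ae Omega v f := {ae lebesgue_rV R n, forall x, Omega x ->
  (forall i, has_partial i (partial i v) x) /\ laplacian v x = f x}.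

Definition ess_sup_norm K g : \bar R :=
  ess_sup (lebesgue_rV R n) (fun x => (\1_K x * `|g x|)%:E).

Definition Linfty_loc Omega f :=
  measurable_fun (Omega : set (caratheodory_type (borel_lebesgue_rV n)^*%mu)) f /\
  forall K, compact K -> K `<=` Omega -> (ess_sup_norm K f < +oo)%E.

Definition modulus_of_continuity (w : R -> R) :=
  [/\ (forall t, 0 <= t -> 0 <= w t),
      (forall s t, 0 <= s -> s <= t -> w s <= w t) &
      w t @[t --> 0^'+] --> 0].

Definition locally_uniformly_littleo Omega (k : nat)
    (F : R -> 'rV[R]_n -> R) :=
  forall K, compact K -> K `<=` Omega -> forall eta : R, 0 < eta ->
  exists2 eps0 : R, 0 < eps0 &
    forall eps, 0 < eps -> eps < eps0 ->
      (ess_sup_norm K (F eps) <= (eta * eps ^+ k)%:E)%E.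

End function_classes.

Section ball_average.
Context {R : realType} {n : nat}.
Implicit Types (g f : 'rV[R]_n -> R) (x : 'rV[R]_n).

Definition ball_avg (r : R) g x : R :=
  (fine (lebesgue_rV R n (eball x r)))^-1 *
  \int[lebesgue_rV R n]_(y in eball x r) g y.

(* Used for 0 <= r <= eps only. *)
Definition avg_kernel (eps r : R) : R := r / n%:R * (1 - (r / eps) ^+ n).

Definition remainder f (eps : R) x : R :=
  \int[lebesgue_measure]_(r in `[0, eps])
    (ball_avg r (fun y => f y - f x) x * avg_kernel eps r).

End ball_average.

Arguments avg_kernel {R} n eps r.

(* Main.v *)
(* Put w = |B_1|, phi(s) = A_s[v](x) and
   W(s) = int_(B_s(x)) (s^2 - |y - x|^2)/2 f(y) dy.
   Scaling to the unit ball and differentiating under the integral sign gives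
     phi'(s) = w^-1 s^(-n-1) int_(B_s(x)) grad v(y) . (y - x) dy.
   Since y - x = - grad ((s^2 - |y - x|^2)/2) and this function vanishes on the
   sphere, one integration by parts turns the last integral into W(s); moreover
   W'(s) = s int_(B_s(x)) f. Hence
     phi(s) + W(s) (s^-n - eps^-n) / (n w)
   is an antiderivative on (0, eps) of A_s[f](x) K_eps(s), with the values v(x) at 0
   and A_eps[v](x) at eps. The expansion and the error bounds then follow from
   int_0^eps K_eps = eps^2 / (2(n + 2)); the expansion in fact holds at every point. *)
Require Import Defs.
From HB Require Import structures.
From mathcomp Require Import all_boot all_order all_algebra.
From mathcomp Require Import all_classical all_reals all_analysis.
From mathcomp Require Import ess_sup_inf measurable_realfun ring lra.

Set Implicit Arguments.
Unset Strict Implicit.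
Unset Printing Implicit Defensive.

Import Order.TTheory GRing.Theory Num.Theory.
Import numFieldNormedType.Exports.

Local Open Scope classical_set_scope.
Local Open Scope ring_scope.

(** The coefficient of [W] is forced: the derivative of [(s^-n - eps^-n) / (n w)] is
    [- s^(-n-1) / w], so its contribution cancels [phi'(s)], and the coefficient vanishes at [eps];
    what survives is [W'(s)] times the coefficient. At 0 the coefficient blows up like [s^-n], but
    [W(s) = O(s^(n+2))]. The obstacle is low regularity. Second derivatives of [v] exist only almost
    everywhere, so the integration by parts is carried out on difference quotients of the Lipschitz
    functions [grad v]. The function [f] is only essentially bounded, so it is truncated; once it is
    bounded, increments of [W] are estimated by volumes of annuli, which makes [W] differentiable at
    every radius without polar coordinates. As [eps] is strictly below the distance to the boundary,
    the analysis takes place on a slightly larger ball of radius [e], where all bounds are uniform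
    and [eps] is an interior radius. The expansion holds at every point because [f(x)] enters it
    only as a constant subtracted inside the averages. *)

Section borel_rV.
Context {R : realType} {n : nat}.
Implicit Types (U : set 'rV[R]_n) (x y : 'rV[R]_n).

(** * Borel sets and Borel functions on R^n *)

Lemma rV_nbhs_box U x : nbhs x U ->
  exists2 e : R, 0 < e & forall y, (forall i, `|x ord0 i - y ord0 i| < e) -> U y.
Proof.
move=> /nbhs_ballP[e /= e0 eU]; exists e => // y xy; apply: eU.
by split => // i j /=; rewrite (ord1 i); exact: xy.
Qed.

(** The sigma-algebra is generated by the coordinates, so openness enters through a countable cover:
    an open set is the union of the boxes with rational centre and half-width [1 / (k + 1)] that it
    contains. *)
Lemma measurable_rV_open U : open U -> measurable U.
Proof.
move=> oU.
pose box (p : 'rV[rat]_n * nat) : set 'rV[R]_n :=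
  [set y | forall i, `|ratr (p.1 ord0 i) - y ord0 i| < p.2.+1%:R^-1].
have mbox p : measurable (box p).
  rewrite (_ : box p = \bigcap_(i in [set: 'I_n])
      (fun y : 'rV[R]_n => y ord0 i : measurableTypeR R) @^-1`
        [set t : R | `|ratr (p.1 ord0 i) - t| < p.2.+1%:R^-1]); last first.
    by apply/seteqP; split => [y h i _|y h i] /=; [exact: h|exact: h].
  apply: fin_bigcap_measurable => // i _.
  rewrite -[X in measurable X]setTI; apply: measurable_rV_coord => //.
  rewrite (_ : mkset _ = ball (ratr (p.1 ord0 i) : R) p.2.+1%:R^-1)//.
  exact: measurable_ball.
(* The second factor is everything or nothing; it selects the boxes inside [U] while the union still
   runs over a whole countable type. *)
rewrite (_ : U = \bigcup_p (box p `&` [set _ | box p `<=` U])); last first.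
  apply/seteqP; split => [x Ux|x [p _ [/= px]]]; last exact.
  have [e e0 eU] := rV_nbhs_box (open_nbhs_nbhs (conj oU Ux)).
  have [k /= ke] := @ltr_add_invr R 0 (e / 2) ltac:(by rewrite divr_gt0).
  rewrite add0r in ke.
  have k0 : 0 < k.+1%:R^-1 :> R by rewrite invr_gt0.
  have q i : {q : rat | `|ratr q - x ord0 i| < k.+1%:R^-1}.
    apply: cid; have [|q] := @rat_in_itvoo R (x ord0 i - k.+1%:R^-1) (x ord0 i + k.+1%:R^-1).
      by rewrite ltrD2l gtrN.
    by rewrite in_itv/= -ltr_distl => ?; exists q.
  exists (\row_i sval (q i), k) => //; split => [i|y yb].
    by rewrite /= mxE; exact: (svalP (q i)).
  apply: eU => i.
  have := yb i; rewrite /= mxE => yi; have xi := svalP (q i).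
  rewrite distrC in xi.
  apply: le_lt_trans (ler_distD (ratr (sval (q i))) _ _) _.
  by rewrite (splitr e) ltrD// (lt_trans _ ke).
apply: countable_bigcupT_measurable => [|p]; first exact: countableP.
have [pU|pU] := pselect (box p `<=` U).
  by rewrite (_ : mkset _ = setT) ?setIT//; apply/seteqP; split.
by rewrite (_ : mkset _ = set0) ?setI0//; apply/seteqP; split.
Qed.

Lemma measurable_fun_rV_continuous U (g : 'rV[R]_n -> R) : open U ->
  (forall x, U x -> {for x, continuous g}) ->
  measurable_fun U (g : 'rV[R]_n -> measurableTypeR R).
Proof.
move=> oU cg; apply: (measurability _ (RGenOpens.measurableE R)).
move=> _ [_ [a [b ->] <-]]; apply: measurable_rV_open.
rewrite openE => x [Ux gx]; apply: filterI.
  exact: open_nbhs_nbhs.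
by apply: (cg x Ux); apply: open_nbhs_nbhs; split => //; exact: interval_open.
Qed.

Lemma measurable_enorm x0 : measurable_fun setT
  (fun y : 'rV[R]_n => enorm (y - x0) : measurableTypeR R).
Proof.
apply: (measurableT_comp (f := @Num.sqrt R)).
  apply: continuous_measurable_fun; exact: sqrt_continuous.
apply: measurable_sum => i.
apply: measurable_funX.
apply: (eq_measurable_fun (fun y : 'rV[R]_n => y ord0 i - x0 ord0 i)).
  by move=> y _; rewrite !mxE.
apply: measurable_funB => //; exact: measurable_rV_coord.
Qed.

Lemma measurable_eball x r : measurable (eball x r).
Proof.
rewrite (_ : eball x r =
  (fun y : 'rV[R]_n => enorm (y - x) : measurableTypeR R) @^-1` `]-oo, r[%classic).
  by rewrite -[X in measurable X]setTI; apply: measurable_enorm.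
by apply/seteqP; split => y; rewrite /= in_itv.
Qed.

End borel_rV.

(** * Lebesgue measure under translations and dilations *)

Section affine.
Context {R : realType}.

Definition affine_rV n (c : 'rV[R]_n) (s : R) (y : 'rV[R]_n) : 'rV[R]_n := c + s *: y.

Lemma measurable_affine_rV n (c : 'rV[R]_n) s : measurable_fun setT (affine_rV c s).
Proof.
apply: measurable_fun_rV => i.
apply: (eq_measurable_fun (fun y : 'rV[R]_n => c ord0 i + s * y ord0 i)).
  by move=> y _; rewrite !mxE.
apply: measurable_funD => //; apply: measurable_funM => //.
exact: measurable_rV_coord.
Qed.

Definition affine1 (c s : R) (t : measurableTypeR R) : measurableTypeR R :=
  c + s * t.

Lemma measurable_affine1 (c s : R) : measurable_fun setT (affine1 c s).
Proof. by apply: measurable_funD => //; exact: measurable_funM. Qed.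

(** By uniqueness of Lebesgue measure: [s] times its push-forward under [t |-> c + s t] gives each
    half-open interval its length. *)
Lemma lebesgue_measure_affine (c s : R) (A : set (measurableTypeR R)) :
  0 < s -> measurable A ->
  (lebesgue_measure A =
   s%:E * lebesgue_measure (affine1 c s @^-1` A))%E.
Proof.
move=> s0 mA.
have ms : measurable_fun setT (affine1 c s) by exact: measurable_affine1.
pose m := pushforward (@lebesgue_measure R) (affine1 c s).
pose nu : {measure set (measurableTypeR R) -> \bar R} := mscale (NngNum (ltW s0)) m.
rewrite (@lebesgue_measure_unique R (nu ms))// => _ [[a b]] _ <- /=.
have pre : affine1 c s @^-1` `]a, b]%classic = `]((a - c) / s), ((b - c) / s)]%classic.
  apply/seteqP; split => t; rewrite /= /affine1 !in_itv/=.
    by rewrite ltr_pdivrMr// ler_pdivlMr// ltrBlDl lerBrDl ![t * s]mulrC.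
  by rewrite ltr_pdivrMr// ler_pdivlMr// ltrBlDl lerBrDl ![t * s]mulrC.
change (lebesgue_measure `]a, b]%classic = s%:E * lebesgue_measure (affine1 c s @^-1` `]a,
  b]%classic))%E.
rewrite pre.
rewrite !lebesgue_measure_itv/= !lte_fin ltr_pM2r ?invr_gt0// ltrD2r.
case: ifPn => _; last by rewrite mule0.
rewrite -!EFinB -EFinM; congr (_%:E).
rewrite -mulrBl mulrCA divff ?gt_eqF// mulr1; ring.
Qed.

Lemma affine_rV_cons n (c : 'rV[R]_n.+1) s (p : measurableTypeR R * 'rV[R]_n) :
  affine_rV c s (rV_cons p) =
  rV_cons (c ord0 ord0 + s * p.1, affine_rV (\row_j c ord0 (lift ord0 j)) s p.2).
Proof.
apply/rowP => i; rewrite [LHS]mxE [X in _ + X]mxE.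
have [j ->|->] := unliftP ord0 i; last by rewrite !rV_cons0.
by rewrite !rV_consS !mxE.
Qed.

(** Induction on the dimension through sections: the slice at [t] of the preimage is the affine
    preimage of the slice of [A] at [c_0 + s t]. The induction hypothesis gives [s^n] on each slice
    and the one-dimensional rule gives the last factor [s]. *)
Lemma borel_lebesgue_affine n (c : 'rV[R]_n) (s : R) (A : set 'rV[R]_n) :
  0 < s -> measurable A ->
  (borel_lebesgue_rV n A =
   (s ^+ n)%:E * borel_lebesgue_rV n (affine_rV c s @^-1` A))%E.
Proof.
move=> s0; elim: n c A => [c A mA|n IH c A mA].
  rewrite expr0 mul1e /= !diracE; congr ((_ : bool)%:R%:E); apply/idP/idP; rewrite !inE /=.
    by rewrite (thinmx0 (affine_rV c s 0)).
  by rewrite (thinmx0 (affine_rV c s 0)).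
rewrite /= /lebesgue_rVS /pushforward.
have mB : measurable (@rV_cons R n @^-1` A).
  by rewrite -[X in measurable X]setTI; exact: measurable_rV_cons.
set B := _ @^-1` A in mB *.
set c' : 'rV[R]_n := \row_j c ord0 (lift ord0 j).
pose a1 := affine1 (c ord0 ord0) s.
have BE : @rV_cons R n @^-1` (affine_rV c s @^-1` A) =
    [set p | B (a1 p.1, affine_rV c' s p.2)].
  by apply/seteqP; split => p /=; rewrite affine_rV_cons.
rewrite BE /product_measure1.
pose h := borel_lebesgue_rV n \o xsection B.
have mh : measurable_fun setT h by exact: measurable_fun_xsection.
have h0 t : (0 <= h t)%E by exact: measure_ge0.
have ma1 : measurable_fun setT a1 by exact: measurable_affine1.
have sn0 : 0 < s ^+ n by rewrite exprn_gt0.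
transitivity (s%:E * \int[lebesgue_measure]_t h (a1 t))%E; last first.
  rewrite exprSr EFinM [((s ^+ n)%:E * _)%E]muleC -muleA; congr *%E.
  rewrite -ge0_integralZl//; [|rewrite ?lee_fin ?ltW//..]; last first.
    apply: measurable_fun_xsection; rewrite -BE -[X in measurable X]setTI.
    apply: measurable_rV_cons => //; rewrite -[X in measurable X]setTI.
    exact: measurable_affine_rV.
  apply: eq_integral => t _ /=; rewrite /h /=.
  rewrite (IH c'); last exact: measurable_xsection.
  congr (_ * borel_lebesgue_rV n _)%E.
have pE := @ge0_integral_pushforward _ _ _ _ _ a1 ma1 lebesgue_measure setT h
  measurableT mh (fun t _ => h0 t).
rewrite preimage_setT in pE.
rewrite -/h -[X in (_ * X)%E]/(integral _ _ (h \o a1)) -pE.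
rewrite -(@ge0_integral_mscale _ _ _ _ _ _ (NngNum (ltW s0)))//.
by apply: eq_measure_integral => X mX _; exact: (lebesgue_measure_affine (c ord0 ord0) s0 mX).
Qed.

End affine.

(** * From Borel sets to the Lebesgue sigma-algebra; affine change of variables *)

Local Notation lebT R n := (caratheodory_type (@borel_lebesgue_rV R n)^*%mu).

Section lebesgue_rV_borel.
Context {R : realType} {n : nat}.
Implicit Types (A : set 'rV[R]_n) (x c : 'rV[R]_n).
Notation mu := (lebesgue_rV R n).

Lemma lebesgue_rV_borel A : measurable A -> mu A = borel_lebesgue_rV n A.
Proof. exact: measurable_mu_extE. Qed.

Lemma measurable_lebesgue_rV A : measurable A -> measurable (A : set (lebT R n)).
Proof. exact: caratheodory_measurable_mu_ext. Qed.

Lemma measurable_to_borel : measurable_fun setT (idfun : lebT R n -> 'rV[R]_n).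
Proof. by move=> _ A mA; rewrite setTI; exact: measurable_lebesgue_rV. Qed.

Lemma measurable_fun_lebesgue d (S : measurableType d) A (g : 'rV[R]_n -> S) :
  measurable A ->
  measurable_fun A g -> measurable_fun (A : set (lebT R n)) g.
Proof. by move=> mA mg mA' B mB; exact: (measurable_lebesgue_rV (mg mA B mB)). Qed.

Lemma lebesgue_rV_affine c s A : 0 < s -> measurable A ->
  (mu A = (s ^+ n)%:E * mu (affine_rV c s @^-1` A))%E.
Proof.
move=> s0 mA; rewrite !lebesgue_rV_borel//; first exact: borel_lebesgue_affine.
by rewrite -[X in measurable X]setTI; exact: measurable_affine_rV.
Qed.

(** For nonnegative functions both sides become integrals over the Borel space, against the
    push-forwards of [mu] by the affine map and by the identity; these are proportional by
    [lebesgue_rV_affine], which speaks of Borel sets, whence the Borel measurability of [g].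
    Positive and negative parts give the signed case. *)
Lemma integral_affine c s (g : 'rV[R]_n -> R) : 0 < s ->
  measurable_fun setT (g : 'rV[R]_n -> measurableTypeR R) ->
  mu.-integrable setT (EFin \o g) ->
  mu.-integrable setT (EFin \o (g \o affine_rV c s)) /\
  \int[mu]_y g (affine_rV c s y) = s ^- n * \int[mu]_y g y.
Proof.
move=> s0 mg ig.
have ma : measurable_fun setT (affine_rV c s : lebT R n -> 'rV[R]_n).
  by apply: measurable_fun_lebesgue => //; exact: measurable_affine_rV.
have mgE : measurable_fun setT (EFin \o g : 'rV[R]_n -> \bar R).
  exact/measurable_EFinP.
have sn0 : 0 < s ^+ n by rewrite exprn_gt0.
have sn0' : (0 <= s ^- n) by rewrite invr_ge0 ltW.
have E (h : 'rV[R]_n -> \bar R) : measurable_fun setT h -> (forall y, 0 <= h y)%E ->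
    (\int[mu]_y h (affine_rV c s y) = (s ^- n)%:E * \int[mu]_y h y)%E.
  move=> mh h0.
  have p1 := @ge0_integral_pushforward _ _ _ _ _ (affine_rV c s : lebT R n -> _) ma mu setT h
    measurableT mh (fun t _ => h0 t).
  have p2 := @ge0_integral_pushforward _ _ _ _ _ _ measurable_to_borel mu setT h
    measurableT mh (fun t _ => h0 t).
  rewrite !preimage_setT in p1 p2.
  rewrite -[LHS]p1 -[X in (_ * X)%E]p2.
  have m0 D : setT D -> (0 <= h D)%E by [].
  have p3 := @ge0_integral_mscale _ _ _ (pushforward mu (idfun : lebT R n -> 'rV[R]_n))
    _ measurableT (NngNum sn0') h mh m0.
  rewrite -[RHS](p3 measurable_to_borel).
  apply: eq_measure_integral => X mX _.
  transitivity ((s ^- n)%:E * mu X)%E => //.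
  by rewrite (lebesgue_rV_affine c s0 mX) muleA -EFinM mulVf ?mul1e// gt_eqF.
have mga : measurable_fun setT (EFin \o (g \o affine_rV c s) : lebT R n -> _).
  exact: (measurableT_comp mgE ma).
have iga : mu.-integrable setT (EFin \o (g \o affine_rV c s)).
  apply/integrableP; split => //.
  rewrite (E (fun y => `|(g y)%:E|%E))//; last exact: measurableT_comp.
  by move/integrableP : ig => [_ ?]; exact: lte_mul_pinfty.
split=> //.
have Ep := E _ (measurable_funepos mgE) (funepos_ge0 _).
have En := E _ (measurable_funeneg mgE) (funeneg_ge0 _).
have Eg : (\int[mu]_y ((EFin \o g) \o affine_rV c s) y =
    (s ^- n)%:E * (\int[mu]_y ((EFin \o g)^\+ y)) -
    (s ^- n)%:E * (\int[mu]_y ((EFin \o g)^\- y)))%E.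
  by rewrite integralE funepos_comp funeneg_comp -Ep -En.
rewrite /Rintegral [X in fine X = _]Eg [in RHS]integralE.
have fp := integrable_fin_num measurableT (integrable_funepos measurableT ig).
have fn' := integrable_fin_num measurableT (integrable_funeneg measurableT ig).
have aux (k : R) (a b : \bar R) : a \is a fin_num -> b \is a fin_num ->
    fine (k%:E * a - k%:E * b)%E = k * fine (a - b)%E.
  by case: a b => [a||] [b||]//= _ _; rewrite mulrBr.
exact: (aux _ _ _ fp fn').
Qed.

End lebesgue_rV_borel.

(** * The Euclidean norm and its balls *)

Section enorm_lemmas.
Context {R : realType} {n : nat}.
Implicit Types (x y : 'rV[R]_n) (r : R).

Lemma enorm_ge0 x : 0 <= enorm x.
Proof. exact: sqrtr_ge0. Qed.

Lemma sqr_enorm x : enorm x ^+ 2 = \sum_(i < n) x ord0 i ^+ 2.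
Proof. by rewrite sqr_sqrtr// sumr_ge0// => i _; exact: sqr_ge0. Qed.

Lemma enormZ (a : R) x : enorm (a *: x) = `|a| * enorm x.
Proof.
rewrite /enorm -sqrtr_sqr -sqrtrM ?sqr_ge0// mulr_sumr.
by congr Num.sqrt; apply: eq_bigr => i _; rewrite mxE exprMn.
Qed.

Lemma enormN x : enorm (- x) = enorm x.
Proof. by rewrite -scaleN1r enormZ normrN1 mul1r. Qed.

Lemma enorm_distC x y : enorm (x - y) = enorm (y - x).
Proof. by rewrite -enormN opprB. Qed.

Lemma le_coord_enorm x i : `|x ord0 i| <= enorm x.
Proof.
rewrite -[X in _ <= X]ger0_norm ?enorm_ge0// -ler_sqr ?nnegrE//.
rewrite !real_normK ?num_real// sqr_enorm (bigD1 i)//= lerDl sumr_ge0// => j _.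
exact: sqr_ge0.
Qed.

Lemma enorm_le_sum x : enorm x <= \sum_(i < n) `|x ord0 i|.
Proof.
have s0 : 0 <= \sum_(i < n) `|x ord0 i| by exact: sumr_ge0.
rewrite -ler_sqr ?nnegrE ?enorm_ge0// sqr_enorm.
have [] // : 0 <= \sum_(i < n) `|x ord0 i| /\
  \sum_(i < n) x ord0 i ^+ 2 <= (\sum_(i < n) `|x ord0 i|) ^+ 2.
apply: (big_ind2 (fun u w => 0 <= w /\ u <= w ^+ 2)).
- by rewrite expr0n.
- move=> u w u' w' [w0 uw] [w'0 uw']; split; first exact: addr_ge0.
  rewrite sqrrD (le_trans (lerD uw uw'))// -addrA lerD2l lerDr.
  by rewrite mulrn_wge0// mulr_ge0.
- by move=> i _; rewrite real_normK ?num_real.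
Qed.

Lemma le_normr_enorm x : `|x| <= enorm x.
Proof.
rewrite [`|x|]mx_normrE; apply: bigmax_le => [|[i j] _]; first exact: enorm_ge0.
by rewrite (ord1 i); exact: le_coord_enorm.
Qed.

Lemma continuous_enorm_sub x : continuous (fun y : 'rV[R]_n => enorm (y - x)).
Proof.
move=> y; apply: (@continuous_comp _ _ _
  (fun y : 'rV[R]_n => \sum_(i < n) (y - x) ord0 i ^+ 2) Num.sqrt);
  last exact: sqrt_continuous.
apply: (@cvg_big R _ +%R 0 predT _ _ (nbhs y)) => [|i _].
  exact: add_continuous.
under eq_fun do rewrite !mxE.
rewrite !mxE; apply: (@continuous_comp _ _ _ (fun y :
  'rV[R]_n => y ord0 i - x ord0 i) (fun t => t ^+ 2)); last exact: exprn_continuous.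
apply: (@continuousB _ _ _ (fun y : 'rV[R]_n => y ord0 i) (cst (x ord0 i)));
  last exact: cst_continuous.
exact: (@coord_continuous _ _ _ ord0 i).
Qed.

Lemma open_eball x r : open (eball x r).
Proof.
rewrite (_ : eball x r = (fun y : 'rV[R]_n => enorm (y - x)) @^-1` [set t | t < r])//.
apply: open_comp; last exact: open_lt.
by move=> y _; exact: continuous_enorm_sub.
Qed.

Definition ceball x r : set 'rV[R]_n := [set y | enorm (y - x) <= r].

Lemma compact_ceball x r : compact (ceball x r).
Proof.
apply: bounded_closed_compact.
- exists (`|x| + r); split; first exact: num_real.
  move=> M rM y /= yr; rewrite -(subrK x y).
  rewrite (le_trans (ler_normD _ _))// (le_trans _ (ltW rM))// addrC lerD2l.
  by rewrite (le_trans (le_normr_enorm _)).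
- rewrite (_ : ceball x r = (fun y : 'rV[R]_n => enorm (y - x)) @^-1` [set t | t <= r])//.
  apply: closed_comp; last exact: closed_le.
  by move=> y _; exact: continuous_enorm_sub.
Qed.

Lemma sub_eball_ceball x r : eball x r `<=` ceball x r.
Proof. by move=> y /ltW. Qed.

Lemma sub_eball x r r' : r <= r' -> eball x r `<=` eball x r'.
Proof. by move=> rr' y /= yr; exact: lt_le_trans rr'. Qed.

End enorm_lemmas.

(** * Volumes of balls *)

Section ball_measure.
Context {R : realType}.

(** The measure of a cube is computable by induction on the dimension; an outer and an inner cube
    show that the volume of the unit ball is finite and positive. *)
Definition cube (n : nat) (M : R) : set 'rV[R]_n := [set y | forall i, `|y ord0 i| <= M].
Arguments cube : clear implicits.

Lemma measurable_cube n M : measurable (cube n M).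
Proof.
rewrite (_ : cube n M = \bigcap_(i in [set: 'I_n])
    (fun y : 'rV[R]_n => y ord0 i : measurableTypeR R) @^-1`
      `[(- M), M]%classic); last first.
  apply/seteqP; split => [y h i _|y h i] /=; first by rewrite in_itv/= -ler_norml.
  by have := h i Logic.I; rewrite /= in_itv/= -ler_norml.
apply: fin_bigcap_measurable => // i _.
by rewrite -[X in measurable X]setTI; apply: measurable_rV_coord.
Qed.

Lemma borel_lebesgue_cube n M : 0 <= M ->
  borel_lebesgue_rV n (cube n M) = ((M *+ 2) ^+ n)%:E.
Proof.
move=> M0; elim: n => [|n IH].
  by rewrite expr0 /= diracE mem_set//= => -[].
rewrite /= /lebesgue_rVS /pushforward.
rewrite (_ : _ @^-1` _ = `[(- M), M]%classic `*` cube n M); last first.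
  apply/seteqP; split => [[t y] h|[t y] [+ h] i] /=.
    split => [|i]; first by rewrite /= in_itv/= -ler_norml -[t]/((t, y).1) -rV_cons0; exact: h.
    by rewrite /= -[y]/((t, y).2) -rV_consS; exact: h.
  rewrite /= in_itv/= -ler_norml => tM.
  by have [j ->|->] := unliftP ord0 i; rewrite ?rV_cons0 ?rV_consS//; exact: h.
rewrite product_measure1E//; last exact: measurable_cube.
rewrite [X in (X * _)%E](lebesgue_measure_itv `[(- M), M]) /= IH lte_fin.
have [->|/eqP M00] := eqVneq M 0; first by rewrite oppr0 ltxx mul0e mul0rn exprS mul0r.
rewrite gtrN ?lt0r ?M0 ?andbT; last exact/eqP.
by rewrite -EFinB -EFinM exprS opprK mulr2n.
Qed.

Context {n : nat}.
Notation mu := (lebesgue_rV R n).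
Implicit Types (x : 'rV[R]_n) (r : R).

Definition unit_ball_volume : R := fine (mu (eball 0 1)).

Lemma lebesgue_eball1_lty : (mu (eball 0%R 1%R) < +oo)%E.
Proof.
apply: (@le_lt_trans _ _ (mu (cube n 1))).
  apply: le_measure; rewrite ?inE.
  - exact: (measurable_lebesgue_rV (measurable_eball _ _)).
  - by apply: measurable_lebesgue_rV; exact: measurable_cube.
  - move=> y /= y1 i; rewrite (le_trans (le_coord_enorm _ _))//.
    by rewrite -[y]subr0 ltW.
rewrite lebesgue_rV_borel; last exact: measurable_cube.
by rewrite borel_lebesgue_cube// ltry.
Qed.

Lemma lebesgue_eball1E : mu (eball 0 1) = unit_ball_volume%:E.
Proof. by rewrite fineK// ge0_fin_numE// lebesgue_eball1_lty. Qed.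

Lemma unit_ball_volume_gt0 : 0 < unit_ball_volume.
Proof.
(* With [n.+1] the sum of [n] coordinates of size [M] is strictly below 1, and it bounds the
   Euclidean norm. *)
pose M : R := n.+1%:R^-1; have M0 : 0 < M by rewrite invr_gt0.
rewrite -lte_fin -lebesgue_eball1E.
apply: (@lt_le_trans _ _ (mu (cube n M))).
  rewrite lebesgue_rV_borel; last exact: measurable_cube.
  by rewrite borel_lebesgue_cube ?ltW// lte_fin exprn_gt0// pmulrn_lgt0.
apply: le_measure; rewrite ?inE.
- by apply: measurable_lebesgue_rV; exact: measurable_cube.
- exact: (measurable_lebesgue_rV (measurable_eball _ _)).
- move=> y /= yM; rewrite /eball /= subr0 (le_lt_trans (enorm_le_sum _))//.
  apply: (@le_lt_trans _ _ (\sum_(i < n) M)); first by apply: ler_sum => i _; exact: yM.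
  by rewrite sumr_const card_ord -[_ *+ _]mulr_natr mulrC ltr_pdivrMr// mul1r ltr_nat.
Qed.

Lemma lebesgue_eball x r : 0 < r -> mu (eball x r) = (unit_ball_volume * r ^+ n)%:E.
Proof.
move=> r0; rewrite (lebesgue_rV_affine x r0); last exact: measurable_eball.
rewrite mulrC EFinM -lebesgue_eball1E; congr (_ * mu _)%E.
have E y : enorm (affine_rV x r y - x) = r * enorm (y - 0).
  by rewrite /affine_rV addrAC subrr add0r subr0 enormZ gtr0_norm.
by apply/seteqP; split => y; rewrite /eball /= E gtr_pMr.
Qed.

Lemma measurable_eballT x r : measurable (eball x r : set (lebT R n)).
Proof. exact: (measurable_lebesgue_rV (measurable_eball _ _)). Qed.

Lemma fine_lebesgue_eball x r : 0 < r ->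
  fine (mu (eball x r)) = unit_ball_volume * r ^+ n.
Proof. by move=> r0; rewrite lebesgue_eball. Qed.

Lemma lebesgue_eball_lty x r : (mu (eball x r) < +oo)%E.
Proof.
have [r0|r0] := ltP 0 r; first by rewrite lebesgue_eball// ltry.
rewrite (_ : eball x r = set0) ?measure0// -subset0 => y /= yr.
by have := lt_le_trans yr r0; rewrite ltNge enorm_ge0.
Qed.

End ball_measure.

(** * Radii below the distance to the boundary, and uniformity on compact sets *)

Section admissible_radius.
Context {R : realType} {n : nat}.
Implicit Types (Omega K U : set 'rV[R]_n) (x y z : 'rV[R]_n) (e : R).

(** A segment from [x] to a point of the closed ball outside [Omega] meets the boundary within
    distance [e]: otherwise the traces on it of [Omega] and of its closure coincide, so that this
    trace is non-empty, open and closed in a connected set. *)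
Lemma ceball_sub_open Omega x e : open Omega -> Omega x ->
  (e%:E < set_dist x (bdry Omega))%E -> ceball x e `<=` Omega.
Proof.
move=> oO Ox ed y xye; apply: contrapT => nOy.
pose c (t : R) := x + t *: (y - x).
have cc : continuous c.
  move=> t; apply: cvgD; first exact: cvg_cst.
  by apply: cvgZr_tmp; exact: cvg_id.
pose S := c @` `[0, 1]%classic.
have cS : connected S.
  apply: connected_continuous_connected; first exact: segment_connected.
  exact: continuous_subspaceT.
have Sx : S x by exists 0; [rewrite /= in_itv/= lexx ler01|rewrite /c scale0r addr0].
have Sy : S y.
  by exists 1; [rewrite /= in_itv/= lexx ler01|rewrite /c scale1r addrC subrK].
suff : S `&` Omega = S by move=> /seteqP[_ /(_ _ Sy)[]].
apply: cS.
- by exists x.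
- by exists Omega.
- exists (closure Omega); first exact: closed_closure.
  apply/seteqP; split => z [Sz]; first by move/subset_closure.
  move=> cOz; split=> //; apply: contrapT => nOz.
  have : (set_dist x (bdry Omega) <= e%:E)%E.
    apply: (@le_trans _ _ (enorm (x - z))%:E).
      apply: ereal_inf_lbound; exists z => //; split=> //.
      by rewrite (proj1 (interior_id _) oO).
    rewrite lee_fin; move: Sz => [t /=]; rewrite in_itv/= => /andP[t0 t1] <-.
    rewrite /c opprD addrA subrr add0r enormN enormZ ger0_norm//.
    by rewrite (le_trans _ xye)// ler_piMl// enorm_ge0.
  by rewrite leNgt ed.
Qed.

(** The gained radius makes [eps] an interior point of the range of radii on which the estimates
    hold. *)
Lemma set_dist_room Omega x e : (e%:E < set_dist x (bdry Omega))%E ->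
  exists2 e', e < e' & (e'%:E < set_dist x (bdry Omega))%E.
Proof.
case: (set_dist _ _) => [d||] //=; rewrite ?lte_fin => ed.
- by exists ((e + d) / 2); rewrite ?lte_fin midf_lt.
- by exists (e + 1); rewrite ?ltrDl// ltry.
Qed.

(** Used in the opposite direction: it makes small radii admissible, as the little-o claims quantify
    over all small [eps]. *)
Lemma lt_set_dist_bdry Omega x d e : open Omega -> eball x d `<=` Omega -> e < d ->
  (e%:E < set_dist x (bdry Omega))%E.
Proof.
move=> oO dO ed; apply: (@lt_le_trans _ _ d%:E); first by rewrite lte_fin.
apply: le_ereal_inf_tmp => _ [y [_ nOy] <-]; rewrite lee_fin leNgt; apply/negP => xyd.
apply: nOy; rewrite (proj1 (interior_id _) oO); apply: dO.
by rewrite /eball /= enorm_distC.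
Qed.

(** A Lebesgue number argument; [z] need not lie in [K]. The same [d] measures closeness and
    parametrizes [Q], so a Lipschitz constant can be stored in it as [d^-1]. *)
Lemma compact_uniform K (Q : R -> 'rV[R]_n -> 'rV[R]_n -> Prop) : compact K ->
  (forall d d' y z, 0 < d' -> d' <= d -> Q d y z -> Q d' y z) ->
  (forall x, K x -> exists U d, [/\ nbhs x U, 0 < d &
     forall y z, U y -> U z -> Q d y z]) ->
  exists2 d, 0 < d & forall y z, K y -> enorm (z - y) < d -> Q d y z.
Proof.
move=> /compact_near_coveringP cK Qd KQ.
pose P (d : R) y := forall z, `|z - y| < d -> Q d y z.
have : \forall d \near 0^'+, K `<=` P d.
  apply: cK => x Kx; have [U [d [/nbhs_ballP[r /= r0 rU] d0 UQ]]] := KQ x Kx.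
  exists (ball x (r / 2), [set d' : R | 0 < d' < Num.min d (r / 2)]).
    split; first by apply: nbhsx_ballx; rewrite divr_gt0.
    have m0 : 0 < Num.min d (r / 2) by rewrite lt_min d0 divr_gt0.
    apply: filterS2 (nbhs_right_gt (0 : R)) (nbhs_right_lt m0) => d' /= -> //.
  move=> [y d'] /= [xy /andP[d'0]]; rewrite lt_min => /andP[d'd d'r] z zy.
  apply: (Qd d) => //; first exact: ltW.
  rewrite mx_norm_ball /ball_ /= in rU xy.
  apply: UQ; apply: rU => /=.
    by rewrite (lt_trans xy)// ltr_pdivrMr// ltr_pMr// ltr1n.
  apply: le_lt_trans (ler_distD y _ _) _.
  by rewrite (splitr r) ltrD// distrC (lt_trans zy).
move=> [d /= d0 dK]; exists (d / 2); rewrite ?divr_gt0// => y z Ky yz.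
apply: (dK (d / 2)) => //=.
- by rewrite sub0r normrN gtr0_norm ?divr_gt0// ltr_pdivrMr// ltr_pMr// ltr1n.
- by rewrite divr_gt0.
- exact: le_lt_trans (le_normr_enorm _) yz.
Qed.

Lemma nbhs_eball x r : 0 < r -> nbhs x (eball x r).
Proof.
move=> r0; apply: open_nbhs_nbhs; split; first exact: open_eball.
by rewrite /eball /= subrr -(scale0r 0) enormZ normr0 mul0r.
Qed.

Lemma locally_lipschitz_compact Omega K (g : 'rV[R]_n -> R) : open Omega ->
  locally_lipschitz Omega g -> compact K -> K `<=` Omega ->
  exists2 d, 0 < d & forall y z, K y -> enorm (z - y) < d ->
    `|g z - g y| <= d^-1 * enorm (z - y).
Proof.
move=> oO lg cK KO.
apply: (@compact_uniform K (fun d y z => `|g z - g y| <= d^-1 * enorm (z - y))) => //.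
  move=> d d' y z d'0 d'd /le_trans; apply.
  by rewrite ler_wpM2r ?enorm_ge0// lef_pV2// posrE// (lt_le_trans d'0).
move=> x Kx; have [r [L [r0 rL]]] := lg x (KO _ Kx).
(* [|L| + 1] instead of [L], since the constant must be positive to be inverted. *)
exists (Omega `&` eball x r), (`|L| + 1)^-1; split.
- apply: filterI; last exact: nbhs_eball.
  by apply: open_nbhs_nbhs; split => //; exact: KO.
- by rewrite invr_gt0 ltr_wpDl.
- move=> y z [Oy yr] [Oz zr]; rewrite (le_trans (rL _ _ Oz Oy zr yr))//.
  rewrite invrK ler_wpM2r ?enorm_ge0// (le_trans (ler_norm _))// lerDl.
  exact: ler01.
Qed.

Lemma continuous_in_compact Omega K (f : 'rV[R]_n -> R) e : open Omega ->
  continuous_in Omega f -> compact K -> K `<=` Omega -> 0 < e ->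
  exists2 d, 0 < d & forall y z, K y -> enorm (z - y) < d ->
    Omega z /\ `|f z - f y| <= e.
Proof.
move=> oO cf cK KO e0.
apply: (@compact_uniform K (fun d y z => Omega z /\ `|f z - f y| <= e)) => //.
move=> x Kx; have Ox := KO _ Kx; have := cf x Ox.
move=> /cvgrPdist_lt/(_ (e / 2)); rewrite divr_gt0// => /(_ isT) xf.
exists (Omega `&` [set y | `|f x - f y| < e / 2]), 1; split => //.
- by apply: filterI => //; apply: open_nbhs_nbhs.
- move=> y z [_ /= fy] [Oz /= fz]; split => //.
  rewrite (le_trans (ler_distD (f x) _ _))// (splitr e) lerD//; last exact: ltW.
  by rewrite distrC ltW.
Qed.

Lemma continuous_in_bounded K Omega (f : 'rV[R]_n -> R) :
  continuous_in Omega f -> compact K -> K `<=` Omega ->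
  exists M, forall y, K y -> `|f y| <= M.
Proof.
move=> cf cK KO.
have : compact (f @` K).
  apply: continuous_compact => //; apply: continuous_in_subspaceT => y.
  by rewrite inE => /KO; exact: cf.
move=> /compact_bounded[M [_ MP]]; exists (M + 1) => y Ky.
by apply: (MP (M + 1)); [rewrite ltrDl|exists y].
Qed.

End admissible_radius.

(** * Directional derivatives of C^1 functions *)

Section chain_rule.
Context {R : realType} {n : nat}.
Implicit Types (Omega : set 'rV[R]_n) (x y z w : 'rV[R]_n) (g : 'rV[R]_n -> R).

Lemma line_quotientE g z w (t : R) :
  (fun h => h^-1 *: ((fun s : R => g (z + s *: w)) (h *: 1 + t) - g (z + t *: w))) =
  (fun h => h^-1 *: (g (h *: w + (z + t *: w)) - g (z + t *: w))).
Proof.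
apply/funext => h; congr (_ *: (g _ - _)).
by rewrite [h *: 1]mulr1 scalerDl addrCA.
Qed.

Lemma derivable_line g z w (t : R) : derivable g (z + t *: w) w ->
  is_derive t 1 (fun s : R => g (z + s *: w)) ('D_w g (z + t *: w)).
Proof.
move=> dg; apply: DeriveDef.
  by rewrite /derivable line_quotientE.
by rewrite /derive line_quotientE.
Qed.

(** The mean value theorem on a coordinate segment; [t] may have either sign, so the intermediate
    point is located by its absolute value only. *)
Lemma partial_mean_value g z i (t : R) :
  (forall s : R, `|s| <= `|t| -> has_partial i g (z + s *: delta_mx ord0 i)) ->
  exists2 s : R, `|s| <= `|t| &
    g (z + t *: delta_mx ord0 i) - g z = t * partial i g (z + s *: delta_mx ord0 i).
Proof.
move=> dg; set e : 'rV[R]_n := delta_mx ord0 i in dg *.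
pose h (s : R) := g (z + s *: e).
have dh (s : R) : `|s| <= `|t| -> is_derive s 1 h (partial i g (z + s *: e)).
  by move=> st; apply: derivable_line; exact: dg.
have h0 : h 0 = g z by rewrite /h scale0r addr0.
have ch (a b : R) : (forall s, s \in `[a, b] -> `|s| <= `|t|) -> {within `[a, b], continuous h}.
  move=> ab; apply: derivable_within_continuous => s /ab st.
  by have [] := dh s st.
have [t0|t0] := leP 0 t.
  have st (s : R) : s \in `[0, t] -> `|s| <= `|t|.
    by rewrite in_itv/= => /andP[s0 st]; rewrite !ger0_norm.
  have [||s sI hE] := @MVT_segment _ h (fun s => partial i g (z + s *: e)) 0 t t0.
  - by move=> s /subset_itv_oo_cc/st/dh.
  - exact: ch.
  by exists s; [exact: st|rewrite -h0 -/(h t) hE subr0 mulrC].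
have st (s : R) : s \in `[t, 0] -> `|s| <= `|t|.
  by rewrite in_itv/= => /andP[ts s0]; rewrite !ler0_norm ?lerN2// ltW.
have [||s sI hE] := @MVT_segment _ h (fun s => partial i g (z + s *: e)) t 0 (ltW t0).
- by move=> s /subset_itv_oo_cc/st/dh.
- exact: ch.
by exists s; [exact: st|rewrite -h0 -/(h t) -opprB hE sub0r mulrN opprK mulrC].
Qed.

(* Telescoping along the staircase path from [z] to [z + u] whose k-th step
   moves only the k-th coordinate. *)
Lemma C1_first_order Omega g z (eta : R) : open Omega -> Omega z -> C1 Omega g ->
  0 < eta -> exists2 d : R, 0 < d & forall u : 'rV[R]_n, (forall i, `|u ord0 i| < d) ->
    `|g (z + u) - g z - \sum_(i < n) u ord0 i * partial i g z| <=
    eta * \sum_(i < n) `|u ord0 i|.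
Proof.
move=> oO Oz [_ pg] eta0.
have : nbhs z (Omega `&` [set y | forall i, `|partial i g z - partial i g y| < eta]).
  apply: filterI; first exact: open_nbhs_nbhs.
  apply: (@filter_forall _ _ (fun i y => `|partial i g z - partial i g y| < eta) (nbhs z)) => i.
  by have [_ /(_ z Oz)/cvgrPdist_lt/(_ eta eta0)] := pg i.
move=> /rV_nbhs_box[d d0 dP]; exists d => // u ud.
pose p k : 'rV[R]_n := \row_j (if (j < k)%N then u ord0 j else 0).
have p0 : p 0%N = 0 by apply/rowP => j; rewrite !mxE.
have pn : p n = u by apply/rowP => j; rewrite !mxE ltn_ord.
have pS (k : 'I_n) : p k.+1 = p k + u ord0 k *: delta_mx ord0 k.
  apply/rowP => j; rewrite !mxE eqxx/= ltnS leq_eqVlt.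
  have [->|jk] := eqVneq j k; first by rewrite eqxx ltnn mulr1 add0r.
  by rewrite -[(_ == _ :> nat)]/(j == k) (negbTE jk) /= mulr0 addr0.
have -> : g (z + u) - g z =
    \sum_(k < n) (g (z + p k.+1) - g (z + p k)).
  rewrite -(big_mkord xpredT (fun k => g (z + p k.+1) - g (z + p k))).
  by rewrite (telescope_sumr (fun k => g (z + p k)))// pn p0 addr0.
rewrite -sumrB (le_trans (ler_norm_sum _ _ _))// mulr_sumr ler_sum// => k _.
have near_z (s : R) : `|s| <= `|u ord0 k| -> forall i,
    `|z ord0 i - (z + p k + s *: delta_mx ord0 k) ord0 i| < d.
  move=> su i; rewrite !mxE eqxx/= -!addrA opprD addrA subrr add0r normrN.
  have [->|ik] := eqVneq i k; first by rewrite ltnn mulr1 add0r (le_lt_trans su).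
  by rewrite mulr0 addr0; case: ifPn => // _; rewrite normr0.
have [|s su] := @partial_mean_value g (z + p k) k (u ord0 k).
  move=> s su; have [dg _] := pg k; apply: dg.
  by have [] := dP _ (near_z s su).
rewrite -addrA -pS => ->.
rewrite -mulrBr normrM mulrC ler_wpM2r// distrC.
by have [_ /(_ k)/ltW] := dP _ (near_z s su).
Qed.

Lemma C1_directional Omega g z w : open Omega -> Omega z -> C1 Omega g ->
  derivable g z w /\ 'D_w g z = \sum_(i < n) w ord0 i * partial i g z.
Proof.
move=> oO Oz Cg; set S := \sum_(i < n) _.
suff cS : h^-1 *: (g (h *: w + z) - g z) @[h --> 0^'] --> S.
  by split; [apply/cvg_ex; exists S|apply/cvg_lim].
apply/cvgrPdist_le => eps eps0.
pose N := \sum_(i < n) `|w ord0 i|.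
have N0 : 0 <= N by exact: sumr_ge0.
(* The first-order error for [u = h w] is [eta |h| N]; dividing by [N + 1] rather than [N] covers
   [w = 0]. *)
have eta0 : 0 < eps / (N + 1) by rewrite divr_gt0// ltr_wpDl.
have [d d0 dP] := C1_first_order oO Oz Cg eta0.
have dN0 : 0 < d / (N + 1) by rewrite divr_gt0// ltr_wpDl.
near=> h.
have h0 : h != 0 by near: h; exact: nbhs_dnbhs_neq.
have hd : `|h| < d / (N + 1) by near: h; exact: dnbhs0_lt.
have hn0 : 0 < `|h| by rewrite normr_gt0.
have wN i : `|w ord0 i| <= N by rewrite /N (bigD1 i)//= lerDl sumr_ge0.
have hw i : `|(h *: w) ord0 i| < d.
  rewrite mxE normrM; apply: (@le_lt_trans _ _ (`|h| * (N + 1))).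
    by rewrite ler_wpM2l// (le_trans (wN i))// lerDl.
  by rewrite -ltr_pdivlMr// ltr_wpDl.
have := dP _ hw.
have -> : \sum_(i < n) (h *: w) ord0 i * partial i g z = h * S.
  by rewrite /S mulr_sumr; apply: eq_bigr => i _; rewrite mxE mulrA.
have -> : \sum_(i < n) `|(h *: w) ord0 i| = `|h| * N.
  by rewrite /N mulr_sumr; apply: eq_bigr => i _; rewrite mxE normrM.
rewrite [z + _]addrC => le1.
rewrite -(ler_pM2l hn0) -normrM mulrBr [h * (_ *: _)]mulrA mulfV// mul1r distrC.
rewrite (le_trans le1)// mulrCA ler_wpM2l// mulrAC ler_pdivrMr ?ltr_wpDl//.
by rewrite ler_wpM2l ?lerDl// ltW.
Unshelve. all: by end_near. Qed.

End chain_rule.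

(** * One-variable derivatives, and integrals of bounded functions *)

Lemma is_derive1_continuous {R : realType} (h : R -> R) (s dh : R) :
  is_derive s 1 h dh -> {for s, continuous h}.
Proof. by case=> + _ => /derivable1_diffP/differentiable_continuous. Qed.

Lemma is_derive1_exprn {R : realType} m (s : R) :
  is_derive s 1 (fun t : R => t ^+ m) (m%:R * s ^+ m.-1).
Proof.
have := @is_deriveX _ _ id m s 1 1 (is_derive_id s 1).
rewrite [_ *: 1]mulr1 (_ : id ^+ m = fun t : R => t ^+ m)//.
by apply/funext => t; rewrite exprfctE.
Qed.

Section bounded_Rintegral.
Context d (T : measurableType d) (R : realType) (mu : {measure set T -> \bar R}).
Implicit Types (D : set T) (g : T -> R).

Lemma bounded_integrable D g (C : R) : measurable D -> (mu D < +oo)%E ->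
  measurable_fun D g -> (forall y, D y -> `|g y| <= C) ->
  mu.-integrable D (EFin \o g).
Proof.
move=> mD Dy mg gC; apply: measurable_bounded_integrable => //.
exists C; split; first exact: num_real.
by move=> C' CC' y Dy' /=; rewrite (le_trans (gC _ Dy'))// ltW.
Qed.

Lemma norm_Rintegral_le D g (C : R) : measurable D -> (mu D < +oo)%E ->
  measurable_fun D g -> (forall y, D y -> `|g y| <= C) ->
  `|\int[mu]_(y in D) g y| <= C * fine (mu D).
Proof.
move=> mD Dy mg gC.
rewrite (le_trans (le_normr_Rintegral mD (bounded_integrable mD Dy mg gC)))//.
rewrite -Rintegral_cst//; apply: le_Rintegral => //.
- apply: (@bounded_integrable _ _ C) => //; first exact: measurableT_comp.
  by move=> y Dy'; rewrite normr_id gC.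
- by apply: (@bounded_integrable _ _ `|C|).
Qed.

Lemma Rintegral_support D g : (forall y, ~ D y -> g y = 0) ->
  \int[mu]_(y in D) g y = \int[mu]_y g y.
Proof.
move=> g0; rewrite Rintegral_mkcond; congr (Rintegral _ _ _).
apply/funext => y; rewrite patchE; case: ifPn => // /negP yD.
by rewrite g0// => Dy; apply: yD; rewrite inE.
Qed.

Lemma Rintegral_sum D n (g : 'I_n -> T -> R) : measurable D ->
  (forall i, mu.-integrable D (EFin \o g i)) ->
  \int[mu]_(y in D) (\sum_(i < n) g i y) = \sum_(i < n) \int[mu]_(y in D) g i y.
Proof.
move=> mD ig; rewrite /Rintegral.
under eq_integral do rewrite -sumEFin.
by rewrite integral_sum// -sum_fine// => i _; exact: (integrable_fin_num mD (ig i)).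
Qed.

(** The domination is by a constant, but convergence is asked almost everywhere only: later the
    second derivatives may fail to exist on a null set, and a sphere has to be discarded. *)
Lemma Rdominated_cvg D (g_ : nat -> T -> R) g (C : R) : measurable D -> (mu D < +oo)%E ->
  (forall k, measurable_fun D (g_ k)) -> measurable_fun D g ->
  {ae mu, forall y, D y -> g_ ^~ y @ \oo --> g y} ->
  (forall k y, D y -> `|g_ k y| <= C) ->
  (fun k => \int[mu]_(y in D) g_ k y) @ \oo --> \int[mu]_(y in D) g y.
Proof.
move=> mD Dy mg_ mg cg gC.
have iC : mu.-integrable D (EFin \o cst C).
  exact: (bounded_integrable (C := `|C|)).
have mg_' k : measurable_fun D (fun y => (g_ k y)%:E) by exact/measurable_EFinP.
have mg' : measurable_fun D (EFin \o g) by exact/measurable_EFinP.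
have cg' : {ae mu, forall y, D y -> (g_ k y)%:E @[k --> \oo] --> (g y)%:E}.
  by apply: filterS cg => y H Dy'; apply: cvg_EFin; [exact: nearW|exact: H].
have gC' : {ae mu, forall y k, D y -> (`|(g_ k y)%:E| <= (cst C y)%:E)%E}.
  by apply: aeW => y k Dy'; rewrite lee_fin; exact: gC.
have [ig _ cvgI] := dominated_convergence mD mg_' mg' cg' iC gC'.
apply: fine_cvg.
rewrite fineK; first exact: cvgI.
exact: integrable_fin_num.
Qed.

End bounded_Rintegral.

(** * Integrals over concentric balls as functions of the radius *)

Section ball_potential.
Context {R : realType} {n : nat}.
Notation mu := (lebesgue_rV R n).
Notation w := (@unit_ball_volume R n).
Variables (x : 'rV[R]_n) (e M : R) (f : 'rV[R]_n -> R).
Hypothesis mf : measurable_fun (eball x e : set (lebT R n)) f.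
Hypothesis fM : forall y, eball x e y -> `|f y| <= M.

Definition ball_integral r := \int[mu]_(y in eball x r) f y.

(* [(r^2 - |y - x|^2) / 2] vanishes on the sphere and has gradient [x - y]. *)
Definition torsion r (y : 'rV[R]_n) : R := (r ^+ 2 - enorm (y - x) ^+ 2) / 2.

(** The function [W]; for [0 < r < e] its derivative is [r * ball_integral r]. *)
Definition torsion_integral r := \int[mu]_(y in eball x r) (torsion r y * f y).

Lemma measurable_torsion r : measurable_fun setT (torsion r : lebT R n -> R).
Proof.
apply: measurable_fun_lebesgue => //.
apply: measurable_funM => //; apply: measurable_funB => //.
by apply: measurable_funX; exact: measurable_enorm.
Qed.

Lemma measurable_torsion_mul r s : s <= e ->
  measurable_fun (eball x s : set (lebT R n)) (fun y => torsion r y * f y).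
Proof.
move=> se; apply: measurable_funM; first exact: measurable_funTS (measurable_torsion r).
apply: measurable_funS mf; [exact: measurable_eballT|exact: sub_eball].
Qed.

Lemma ball_bound_ge0 : 0 < e -> 0 <= M.
Proof.
move=> e0; apply: le_trans (normr_ge0 (f x)) (fM _).
by rewrite /eball /= subrr -(scale0r 0) enormZ normr0 mul0r.
Qed.

Lemma ball_integral_le r : 0 < r -> r <= e ->
  `|ball_integral r| <= M * (w * r ^+ n).
Proof.
move=> r0 re; rewrite -(fine_lebesgue_eball x r0); apply: norm_Rintegral_le.
- exact: measurable_eballT.
- exact: lebesgue_eball_lty.
- by apply: measurable_funS mf; [exact: measurable_eballT|exact: sub_eball].
- by move=> y /(sub_eball re); exact: fM.
Qed.

Lemma torsion_ge0 r y : 0 <= r -> eball x r y -> 0 <= torsion r y.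
Proof.
move=> r0 yr; rewrite /torsion divr_ge0// subr_ge0.
by rewrite ler_sqr ?nnegrE ?enorm_ge0//; exact: ltW.
Qed.

Lemma torsion_le r y : torsion r y <= r ^+ 2 / 2.
Proof. by rewrite ler_pM2r// gerBl sqr_ge0. Qed.

Lemma torsion_integral_le r : 0 < r -> r <= e ->
  `|torsion_integral r| <= r ^+ 2 / 2 * M * (w * r ^+ n).
Proof.
move=> r0 re; rewrite -(fine_lebesgue_eball x r0); apply: norm_Rintegral_le.
- exact: measurable_eballT.
- exact: lebesgue_eball_lty.
- exact: measurable_torsion_mul.
- move=> y yr; rewrite normrM ler_pM//; last by apply: fM; exact: (sub_eball re).
  by rewrite ger0_norm ?torsion_le// torsion_ge0// ltW.
Qed.

Section annulus.
Variables r r' : R.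
Hypotheses (r0 : 0 < r) (rr' : r <= r') (r'e : r' <= e).

Let A := eball x r' `\` eball x r.

Let mA : measurable (A : set (lebT R n)).
Proof. by apply: measurableD; exact: measurable_eballT. Qed.

Let Ay : (mu A < +oo)%E.
Proof.
apply: (@le_lt_trans _ _ (mu (eball x r'))); last exact: lebesgue_eball_lty.
by apply: le_measure; rewrite ?inE//; [exact: measurable_eballT|exact: subDsetl].
Qed.

Let Ae : A `<=` eball x e.
Proof. by move=> y [yr' _]; exact: (sub_eball r'e). Qed.

Let muA : fine (mu A) = w * (r' ^+ n - r ^+ n).
Proof.
rewrite measureD; [|exact: measurable_eballT..|exact: lebesgue_eball_lty].
rewrite setIidr; last exact: sub_eball.
rewrite -[X in fine X]/(mu (eball x r') - mu (eball x r))%E.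
by rewrite !lebesgue_eball ?(lt_le_trans r0)// -EFinB /= mulrBr.
Qed.

Let split_ball (g : 'rV[R]_n -> R) C :
  measurable_fun (eball x r' : set (lebT R n)) g ->
  (forall y, eball x r' y -> `|g y| <= C) ->
  \int[mu]_(y in eball x r') g y =
  \int[mu]_(y in eball x r) g y + \int[mu]_(y in A) g y.
Proof.
move=> mg gC.
have UE : eball x r' = eball x r `|` A by rewrite setUDr setDv setD0 setUidr//; exact: sub_eball.
rewrite {1}UE Rintegral_setU//.
- exact: measurable_eballT.
- rewrite -UE; apply: (@bounded_integrable _ _ _ mu _ _ C _ _ mg gC).
  + exact: measurable_eballT.
  + exact: lebesgue_eball_lty.
- by apply/disj_setPS => y [? []].
Qed.

Lemma ball_integral_diff : `|ball_integral r' - ball_integral r| <=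
  M * (w * (r' ^+ n - r ^+ n)).
Proof.
rewrite /ball_integral (split_ball (C := M)).
- rewrite addrAC subrr add0r -muA; apply: (norm_Rintegral_le mA Ay).
  by apply: measurable_funS mf => //; exact: measurable_eballT.
  by move=> y /Ae; exact: fM.
- by apply: measurable_funS mf; [exact: measurable_eballT|exact: sub_eball].
- by move=> y /(sub_eball r'e); exact: fM.
Qed.

(** On the inner ball [torsion r' - torsion r] is the constant [(r'^2 - r^2) / 2], which accounts
    exactly for the subtracted term; on the annulus [torsion r'] is at most that constant, because
    [|y - x| >= r]. The error is thus of second order in [r' - r]. *)
Lemma torsion_integral_diff :
  `|torsion_integral r' - torsion_integral r -
    (r' ^+ 2 - r ^+ 2) / 2 * ball_integral r| <=
  (r' ^+ 2 - r ^+ 2) / 2 * M * (w * (r' ^+ n - r ^+ n)).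
Proof.
have r'0 : 0 < r' by exact: lt_le_trans rr'.
have re := le_trans rr' r'e.
have mTf s : s <= e -> measurable_fun (eball x s : set (lebT R n)) (fun y => torsion r' y * f y).
  exact: measurable_torsion_mul.
have bTf y : eball x r' y -> `|torsion r' y * f y| <= r' ^+ 2 / 2 * M.
  move=> yr; rewrite normrM ler_pM//; last by apply: fM; exact: (sub_eball r'e).
  by rewrite ger0_norm ?torsion_le// torsion_ge0// ltW.
have mfr : measurable_fun (eball x r : set (lebT R n)) f.
  by apply: measurable_funS mf; [exact: measurable_eballT|exact: sub_eball].
have ifr : mu.-integrable (eball x r : set (lebT R n)) (EFin \o f).
  apply: (@bounded_integrable _ _ _ mu _ _ M _ _ mfr).
  - exact: measurable_eballT.
  - exact: lebesgue_eball_lty.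
  - by move=> y /(sub_eball re); exact: fM.
have iTr : mu.-integrable (eball x r : set (lebT R n)) (EFin \o (fun y => torsion r y * f y)).
  have mTr := @measurable_torsion_mul r _ re.
  apply: (@bounded_integrable _ _ _ mu _ _ (r ^+ 2 / 2 * M) _ _ mTr).
  - exact: measurable_eballT.
  - exact: lebesgue_eball_lty.
  - move=> y yr; rewrite normrM ler_pM//; last by apply: fM; exact: (sub_eball re).
    by rewrite ger0_norm ?torsion_le// torsion_ge0// ltW.
rewrite /torsion_integral (split_ball (mTf _ r'e) bTf).
have -> : \int[mu]_(y in eball x r) (torsion r' y * f y) =
    torsion_integral r + (r' ^+ 2 - r ^+ 2) / 2 * ball_integral r.
  rewrite /torsion_integral /ball_integral -RintegralZl//; last exact: measurable_eballT.
  rewrite -RintegralD//; [|exact: measurable_eballT|].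
    by apply: eq_Rintegral => y _; rewrite -mulrDl -mulrDl addrC addrA subrK.
  under [X in integrable _ _ X]eq_fun do rewrite /= EFinM.
  by apply: integrableZl => //; exact: measurable_eballT.
rewrite (_ : _ + _ + _ - _ - _ = \int[mu]_(y in A) (torsion r' y * f y)); last first.
  by rewrite /torsion_integral; ring.
rewrite -muA; apply: (norm_Rintegral_le mA Ay).
- by apply: measurable_funS (mTf _ r'e); [exact: measurable_eballT|exact: subDsetl].
- move=> y [yr' /negP]; rewrite -leNgt => ry.
  rewrite normrM ler_pM//; last by apply: fM; exact: (sub_eball r'e).
  rewrite ger0_norm; last by rewrite torsion_ge0// ltW.
  by rewrite ler_pM2r// lerD2l lerN2 ler_sqr ?nnegrE ?enorm_ge0// ltW.
Qed.

End annulus.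

(** Two-sided form of the preceding estimate. When [s < r] the latter involves the ball integral at
    [s]; replacing it by the one at [r] costs as much again, which is why the factor [1/2] is
    gone. *)
Lemma torsion_integral_est r s : 0 < r -> r <= e -> 0 < s -> s <= e ->
  `|torsion_integral s - torsion_integral r -
    (s ^+ 2 - r ^+ 2) / 2 * ball_integral r| <=
  `|s ^+ 2 - r ^+ 2| * M * (w * `|s ^+ n - r ^+ n|).
Proof.
move=> r0 re s0 se.
have M0 : 0 <= M by exact: ball_bound_ge0 (lt_le_trans r0 re).
have w0 := ltW (@unit_ball_volume_gt0 R n).
have pos a b : 0 <= a -> a <= b -> 0 <= b ^+ 2 - a ^+ 2 :> R /\ 0 <= b ^+ n - a ^+ n.
  by move=> a0 ab; rewrite !subr_ge0 !lerXn2r// nnegrE// (le_trans a0).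
have [rs|sr] := leP r s.
  have [p2 pn] := pos _ _ (ltW r0) rs.
  rewrite (le_trans (torsion_integral_diff r0 rs se))// !ger0_norm//.
  rewrite ler_wpM2r ?mulr_ge0// ler_wpM2r// ler_pdivrMr// ler_peMr// ler1n //.
have [p2 pn] := pos _ _ (ltW s0) (ltW sr).
have h1 := torsion_integral_diff s0 (ltW sr) re.
have h2 := ball_integral_diff s0 (ltW sr) re.
rewrite [`|s ^+ 2 - _|]distrC [`|s ^+ n - _|]distrC (ger0_norm p2) (ger0_norm pn).
rewrite (_ : _ - _ - _ = - (torsion_integral r - torsion_integral s -
  (r ^+ 2 - s ^+ 2) / 2 * ball_integral s) +
  (r ^+ 2 - s ^+ 2) / 2 * (ball_integral r - ball_integral s)); last by ring.
rewrite (le_trans (ler_normD _ _))// normrN.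
rewrite [leRHS](_ : _ = (r ^+ 2 - s ^+ 2) / 2 * M * (w * (r ^+ n - s ^+ n)) +
  (r ^+ 2 - s ^+ 2) / 2 * (M * (w * (r ^+ n - s ^+ n)))); last by field.
apply: lerD => //.
by rewrite normrM ger0_norm ?divr_ge0// ler_wpM2l// divr_ge0.
Qed.

Lemma continuous_ball_integral r : 0 < r -> r < e -> {for r, continuous ball_integral}.
Proof.
move=> r0 re.
have M0 : 0 <= M by exact: ball_bound_ge0 (lt_trans r0 re).
have w0 := ltW (@unit_ball_volume_gt0 R n).
have cb : (fun s : R => M * (w * `|s ^+ n - r ^+ n|)) @ r --> 0.
  rewrite [X in _ --> X](_ : _ = M * (w * `|r ^+ n - r ^+ n|)); last by rewrite subrr normr0 !mulr0.
  apply: cvgMr; apply: cvgMr; apply: cvg_norm.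
  by apply: cvgB; [exact: exprn_continuous|exact: cvg_cst].
apply/subr_cvg0; apply: norm_cvg0.
apply: (@squeeze_cvgr _ _ _ _ (cst 0) _ _ _ _ _ cb); last exact: cvg_cst.
near=> s.
have s0 : 0 < s by near: s; exact: lt_nbhsr.
have se : s < e by near: s; exact: lt_nbhsl.
rewrite normr_ge0 /=; have [rs|sr] := leP r s.
  by rewrite (le_trans (ball_integral_diff r0 rs (ltW se)))// ler_wpM2l// ler_wpM2l// ler_norm.
rewrite distrC (le_trans (ball_integral_diff s0 (ltW sr) (ltW re)))//.
by rewrite [`|_ - r ^+ n|]distrC ler_wpM2l// ler_wpM2l// ler_norm.
Unshelve. all: by end_near. Qed.

Lemma is_derive_torsion_integral r : 0 < r -> r < e ->
  is_derive r 1 torsion_integral (r * ball_integral r).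
Proof.
move=> r0 re.
suff cD : h^-1 *: (torsion_integral (h *: 1 + r) - torsion_integral r) @[h --> 0^']
    --> r * ball_integral r.
  by apply: DeriveDef; [apply/cvg_ex; exists (r * ball_integral r)|exact/cvg_lim].
apply: cvg_zero.
(* Since [((h + r)^2 - r^2) / 2 = h r + h^2 / 2], division by [h] leaves [q] besides the expected
   derivative; [b] is the bound of [torsion_integral_est] divided by [|h|]. *)
pose q (h : R) := h / 2 * ball_integral r.
pose b (h : R) := `|2 * r + h| * M * (w * `|(h + r) ^+ n - r ^+ n|).
have cq : q h @[h --> 0^'] --> 0.
  rewrite [X in _ --> X](_ : _ = 0 / 2 * ball_integral r); last by rewrite !mul0r.
  by apply: cvgMl; apply: cvgMl; exact: cvg_within.
have cb : b h @[h --> 0^'] --> 0.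
  rewrite [X in _ --> X](_ : _ = `|2 * r + 0| * M * (w * `|(0 + r) ^+ n - r ^+ n|)); last first.
    by rewrite add0r subrr normr0 !mulr0.
  apply: cvg_within_filter.
  apply: cvgM.
    apply: cvgMl; apply: cvg_norm; apply: cvgD; [exact: cvg_cst|exact: cvg_id].
  apply: cvgMr; apply: cvg_norm; apply: cvgB; last exact: cvg_cst.
  apply: (@continuous_comp _ _ _ (fun h => h + r) (fun t => t ^+ n)); last exact: exprn_continuous.
  by apply: cvgD; [exact: cvg_id|exact: cvg_cst].
have cbq : b h + `|q h| @[h --> 0^'] --> 0.
  by rewrite -[X in _ --> X]addr0 -[X in _ --> _ + X](@normr0 _ R); apply: cvgD => //;
    exact: cvg_norm.
apply: norm_cvg0; apply: (@squeeze_cvgr _ _ _ _ (cst 0) _ _ _ _ _ cbq); last exact: cvg_cst.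
near=> h; rewrite normr_ge0/=.
have h0 : h != 0 by near: h; exact: nbhs_dnbhs_neq.
have hr : `|h| < Num.min r (e - r) by near: h; apply: dnbhs0_lt; rewrite lt_min r0 subr_gt0.
move: hr; rewrite lt_min => /andP[hr her].
have s0 : 0 < h + r by move: hr; rewrite ltr_norml -ltrBlDr sub0r => /andP[].
have se : h + r <= e by rewrite -lerBrDr (le_trans (ler_norm _))// ltW.
have := torsion_integral_est r0 (ltW re) s0 se.
move=> est.
rewrite [X in `|X| <= _](_ : _ = h^-1 * (torsion_integral (h + r) - torsion_integral r) -
  r * ball_integral r); last by rewrite !fctE /GRing.scale /= mulr1.
have hn0 : 0 < `|h| by rewrite normr_gt0.
rewrite -(ler_pM2l hn0) -normrM.
rewrite (_ : h * _ = (torsion_integral (h + r) - torsion_integral r -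
    ((h + r) ^+ 2 - r ^+ 2) / 2 * ball_integral r) + h * q h); last first.
  by rewrite /q; field.
rewrite (le_trans (ler_normD _ _))// mulrDr normrM lerD2r (le_trans est)//.
rewrite /b (_ : (h + r) ^+ 2 - r ^+ 2 = h * (2 * r + h)); last by ring.
by rewrite normrM !mulrA.
Unshelve. all: by end_near. Qed.

End ball_potential.

(** * Spheres are null sets; difference quotients of the positive part *)

Section sphere.
Context {R : realType} {n : nat}.
Notation mu := (lebesgue_rV R n).
Notation w := (@unit_ball_volume R n).
Implicit Types (x y u : 'rV[R]_n).

(** For every [d > 0] the sphere lies in the annulus between the radii [r] and [r + d], whose volume
    tends to 0 with [d]. *)
Lemma ae_not_sphere x (r : R) : 0 < r -> {ae mu, forall y, enorm (y - x) != r}.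
Proof.
move=> r0; pose S : set (lebT R n) := [set y | enorm (y - x) = r].
have mS : measurable S.
  apply: measurable_lebesgue_rV.
  rewrite (_ : S = (fun y : 'rV[R]_n => enorm (y - x) : measurableTypeR R) @^-1` [set r])//.
  by rewrite -[X in measurable X]setTI; apply: measurable_enorm => //; exact: measurable_set1.
have Sle (d : R) : 0 < d -> (mu S <= (w * ((r + d) ^+ n - r ^+ n))%:E)%E.
  move=> d0.
  have -> : (w * ((r + d) ^+ n - r ^+ n))%:E = mu (eball x (r + d) `\` eball x r).
    rewrite measureD; [|exact: measurable_eballT..|exact: lebesgue_eball_lty].
    rewrite setIidr; last by apply: sub_eball; rewrite lerDl ltW.
    rewrite -[RHS]/(mu (eball x (r + d)) - mu (eball x r))%E.
    by rewrite !lebesgue_eball ?addr_gt0// -EFinB mulrBr.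
  apply: le_measure; rewrite ?inE//.
    by apply: measurableD; exact: measurable_eballT.
  by move=> y /= yr; rewrite /eball /= yr ltrDl ltxx.
exists S; split => //; last by move=> y /= /negP; rewrite negbK => /eqP.
apply/eqP; rewrite eq_le measure_ge0 andbT; apply/lee_addgt0Pr => eps eps0.
rewrite add0e.
have c0 : w * ((r + d) ^+ n - r ^+ n) @[d --> (0 : R)^'+] --> 0.
  rewrite [X in _ --> X](_ : _ = w * ((r + 0) ^+ n - r ^+ n)); last by rewrite addr0 subrr mulr0.
  apply: cvg_within_filter.
  apply: cvgMr; apply: cvgB; last exact: cvg_cst.
  apply: (@continuous_comp _ _ _ (fun h => r + h) (fun t => t ^+ n)); last exact: exprn_continuous.
  by apply: cvgD; [exact: cvg_cst|exact: cvg_id].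
near ((0 : R)^'+) => d.
have d0 : 0 < d by near: d; exact: nbhs_right_gt.
apply: (le_trans (Sle d d0)); rewrite lee_fin (le_trans (ler_norm _))//.
by near: d; move/cvgr0_norm_le : c0; apply.
Unshelve. all: by end_near. Qed.

Lemma sqr_enorm_shift u i (h : R) :
  enorm (u + h *: delta_mx ord0 i) ^+ 2 = enorm u ^+ 2 + 2 * h * u ord0 i + h ^+ 2.
Proof.
rewrite !sqr_enorm (bigD1 i)//= [in RHS](bigD1 i)//= !mxE !eqxx mulr1.
rewrite (eq_bigr (fun j => u ord0 j ^+ 2)); last first.
  by move=> j /negbTE ji; rewrite !mxE ji andbF mulr0 addr0.
by ring.
Qed.

Lemma enorm_delta i : enorm (delta_mx ord0 i : 'rV[R]_n) = 1.
Proof.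
apply/eqP; rewrite -(@eqrXn2 _ 2)//; last exact: enorm_ge0.
have := sqr_enorm_shift 0 i 1; rewrite scale1r add0r => ->.
by rewrite sqr_enorm big1 ?mxE ?mulr0 ?add0r// => j _; rewrite mxE expr0n.
Qed.

Lemma torsion_shift x r y i (h : R) :
  torsion x r (y - h *: delta_mx ord0 i) =
  torsion x r y + (h * (y - x) ord0 i - h ^+ 2 / 2).
Proof.
rewrite /torsion (_ : y - _ - x = (y - x) + (- h) *: delta_mx ord0 i); last first.
  by rewrite scaleNr addrAC.
by rewrite sqr_enorm_shift; field.
Qed.

End sphere.

Lemma max0_lipschitz {R : realType} (a b : R) :
  `|Num.max 0 a - Num.max 0 b| <= `|a - b|.
Proof. have [a0|a0] := lerP 0 a; have [b0|b0] := lerP 0 b => //.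
- by rewrite subr0 ger0_norm// (le_trans _ (ler_norm _))// lerBrDr gerDl ltW.
- by rewrite sub0r normrN ger0_norm// distrC (le_trans _ (ler_norm _))// lerBrDr gerDl ltW.
- by rewrite subrr normr0. Qed.

(** Away from the kink [q = 0], the positive part acts for large [k] on both arguments as the
    identity or as zero. For [q = torsion x r y] the increment is that of [torsion_shift] and the
    kink is the sphere. *)
Lemma max0_quotient_cvg {R : realType} (q p : R) (h : R^nat) : q != 0 ->
  (forall k, 0 < h k) -> h @ \oo --> 0 ->
  (h k)^-1 * (Num.max 0 (q + (h k * p - h k ^+ 2 / 2)) - Num.max 0 q)
    @[k --> \oo] --> if 0 < q then p else 0.
Proof.
move=> q0 h0 hcvg.
have cq : q + (h k * p - h k ^+ 2 / 2) @[k --> \oo] --> q.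
  rewrite -[X in _ --> X](_ : q + (0 * p - 0 ^+ 2 / 2) = q);
    last by rewrite expr0n /= !mul0r subr0 addr0.
  apply: cvgD; first exact: cvg_cst.
  apply: cvgB; first exact: cvgMl.
  by apply: cvgMl; rewrite expr2; under eq_fun do rewrite expr2; exact: cvgM.
case: ifPn => qp.
  have cp : p - h k / 2 @[k --> \oo] --> p.
    rewrite -[X in _ --> X](_ : p - 0 / 2 = p); last by rewrite mul0r subr0.
    by apply: cvgB; [exact: cvg_cst|exact: cvgMl].
  apply: cvg_trans cp; apply: near_eq_cvg; near=> k.
  have Q : 0 < q + (h k * p - h k ^+ 2 / 2).
    by near: k; move/cvgr_gt : cq; apply.
  rewrite !max_r ?ltW//; have := h0 k => /gt_eqF/negbT hk0; by field.
have qn : q < 0 by rewrite lt_neqAle q0 leNgt.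
apply: cvg_near_cst; near=> k.
have Q : q + (h k * p - h k ^+ 2 / 2) < 0.
  by near: k; move/cvgr_lt : cq; apply.
by rewrite !max_l ?ltW// subrr mulr0.
Unshelve. all: by end_near. Qed.

(** * Integration by parts against the torsion function *)

Section weak_identity.
Context {R : realType} {n : nat}.
Notation mu := (lebesgue_rV R n).
Notation delta i := (delta_mx ord0 i : 'rV[R]_n).
Variables (x : 'rV[R]_n) (e d G L : R).
Variables (f : 'rV[R]_n -> R) (g : 'I_n -> 'rV[R]_n -> R).
Let D := eball x e.
Hypothesis mf : measurable_fun (D : set (lebT R n)) f.
Hypothesis d0 : 0 < d.
Hypothesis gC : forall i y, D y -> {for y, continuous (g i)}.
Hypothesis gG : forall i y, D y -> `|g i y| <= G.
Hypothesis gL : forall i y z, D y -> enorm (z - y) < d ->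
  `|g i z - g i y| <= L * enorm (z - y).
Hypothesis gf : {ae mu, forall y, D y ->
  (forall i, has_partial i (g i) y) /\ \sum_(i < n) partial i (g i) y = f y}.

Variable r : R.
Hypotheses (r0 : 0 < r) (re : r < e).

Let B := eball x r.
Let eta (y : 'rV[R]_n) : R := Num.max 0 (torsion x r y).
(** Extension by zero: the hypotheses control [g i] near [D] only, while the translation is applied
    on the whole space. *)
Let gt i : 'rV[R]_n -> R := g i \_ D.

Let BD : B `<=` D. Proof. exact/sub_eball/ltW. Qed.
Let mD : measurable (D : set (lebT R n)). Proof. exact: measurable_eballT. Qed.
Let mB : measurable (B : set (lebT R n)). Proof. exact: measurable_eballT. Qed.
Let Dy : (mu D < +oo)%E. Proof. exact: lebesgue_eball_lty. Qed.

Let gtE i y : D y -> gt i y = g i y.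
Proof. by move=> yD; rewrite /gt patchE mem_set. Qed.

Let gt0 i y : ~ D y -> gt i y = 0.
Proof. by move=> yD; rewrite /gt patchE memNset. Qed.

Let etaE y : B y -> eta y = torsion x r y.
Proof. by move=> yB; rewrite /eta max_r// torsion_ge0// ltW. Qed.

Let eta0 y : ~ B y -> eta y = 0.
Proof.
move=> /negP; rewrite -leNgt => ry; rewrite /eta max_l// /torsion.
rewrite pmulr_lle0// subr_le0 ler_sqr ?nnegrE ?enorm_ge0//; exact: ltW.
Qed.

Let eta_le y : `|eta y| <= r ^+ 2 / 2.
Proof.
rewrite ger0_norm; last by rewrite /eta le_max lexx.
by rewrite /eta ge_max torsion_le divr_ge0// sqr_ge0.
Qed.

Let mgt i : measurable_fun setT (gt i : 'rV[R]_n -> measurableTypeR R).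
Proof.
apply/(measurable_restrict (g i) (measurable_eball x e) measurableT).
rewrite setTI; apply: measurable_fun_rV_continuous; first exact: open_eball.
exact: gC.
Qed.

Let meta : measurable_fun setT (eta : 'rV[R]_n -> measurableTypeR R).
Proof.
apply: measurable_maxr => //.
apply: measurable_funM => //; apply: measurable_funB => //.
by apply: measurable_funX; exact: measurable_enorm.
Qed.

Let gt_le i y : `|gt i y| <= `|G|.
Proof.
have [yD|yD] := pselect (D y); last by rewrite gt0// normr0.
by rewrite gtE// (le_trans (gG i yD))// ler_norm.
Qed.

Let mshift (k : 'rV[R]_n -> R) c :
  measurable_fun setT (k : 'rV[R]_n -> measurableTypeR R) ->
  measurable_fun setT ((fun y => k (y + c)) : 'rV[R]_n -> measurableTypeR R).
Proof.
move=> mk; apply: (eq_measurable_fun (k \o affine_rV c 1)).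
  by move=> y _; rewrite /= /affine_rV scale1r addrC.
by apply: measurableT_comp => //; exact: measurable_affine_rV.
Qed.

Let mLeb (k : 'rV[R]_n -> R) :
  measurable_fun setT (k : 'rV[R]_n -> measurableTypeR R) ->
  measurable_fun (D : set (lebT R n)) k.
Proof.
move=> mk; apply: (@measurable_funS _ _ _ _ setT) => //.
exact: measurable_fun_lebesgue.
Qed.

(** Below [d] for the Lipschitz bound, and below [e - r] so that translating [B] stays in [D]; the
    factor [1/2] keeps both strict at [k = 0]. *)
Let step k : R := Num.min d (e - r) / 2 / k.+1%:R.

Let step_gt0 k : 0 < step k.
Proof. by rewrite /step !divr_gt0// lt_min d0 subr_gt0. Qed.

Let step_lt k : step k < Num.min d (e - r).
Proof.
have m0 : 0 < Num.min d (e - r) by rewrite lt_min d0 subr_gt0.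
rewrite /step -mulrA -[X in _ < X]mulr1 ltr_pM2l// -invfM invf_lt1//.
by rewrite -natrM ltr1n mulnS.
Qed.

Let step_cvg : step @ \oo --> 0.
Proof.
rewrite -[X in _ --> X](mulr0 (Num.min d (e - r) / 2)).
by apply: cvgMr; exact: cvg_harmonic.
Qed.

Let shift_in_D k i y : B y -> D (y + step k *: delta i).
Proof.
move=> yB; rewrite /D /eball /= addrAC.
have h0 := step_gt0 k.
have hr : step k < e - r by apply: lt_le_trans (step_lt k) _; rewrite ge_min lexx orbT.
apply: (@le_lt_trans _ _ (r + step k)); last by rewrite -ltrBrDl.
have rh : 0 <= r + step k by rewrite addr_ge0// ltW.
have yr : enorm (y - x) <= r by exact: ltW.
rewrite -ler_sqr ?nnegrE ?enorm_ge0// sqr_enorm_shift sqrrD.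
apply: lerD => //; apply: lerD; first by rewrite ler_sqr ?nnegrE ?enorm_ge0// ltW.
rewrite (_ : r * step k *+ 2 = 2 * step k * r); last by ring.
apply: ler_wpM2l; first by rewrite mulr_ge0// ltW.
by rewrite (le_trans (ler_norm _))// (le_trans (le_coord_enorm _ _)).
Qed.

(** Summation by parts: the forward quotient of [g i] in [phi1] is traded for the backward quotient
    of [eta] in [phi2]. On [B] the latter tends to [g i y * (y - x)_i], as the gradient of the
    torsion function is [x - y]. *)
Let phi1 k i y := (step k)^-1 *
  (gt i (y + step k *: delta i) * eta y - gt i y * eta y).
Let phi2 k i y := (step k)^-1 *
  (gt i y * eta (y - step k *: delta i) - gt i y * eta y).

Let mphi1 k i : measurable_fun (D : set (lebT R n)) (phi1 k i).
Proof.
apply: mLeb; apply: measurable_funM => //; apply: measurable_funB.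
  exact: (measurable_funM (mshift _ (mgt i)) meta).
exact: (measurable_funM (mgt i) meta).
Qed.

Let mphi2 k i : measurable_fun (D : set (lebT R n)) (phi2 k i).
Proof.
apply: mLeb; apply: measurable_funM => //; apply: measurable_funB.
  exact: (measurable_funM (mgt i) (mshift _ meta)).
exact: (measurable_funM (mgt i) meta).
Qed.

Let prod_le i y z : `|gt i y * eta z| <= `|G| * (r ^+ 2 / 2).
Proof. by rewrite normrM ler_pM. Qed.

Let iphi1 k i : mu.-integrable D (EFin \o phi1 k i).
Proof.
apply: (@bounded_integrable _ _ _ mu D _ ((step k)^-1 *
  (`|G| * (r ^+ 2 / 2) + `|G| * (r ^+ 2 / 2))) mD Dy (mphi1 k i)) => y _.
have si : 0 <= (step k)^-1 by rewrite invr_ge0 ltW.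
rewrite /phi1 normrM (ger0_norm si) ler_wpM2l//.
by rewrite (le_trans (ler_normB _ _))// lerD.
Qed.

Let iphi2 k i : mu.-integrable D (EFin \o phi2 k i).
Proof.
apply: (@bounded_integrable _ _ _ mu D _ ((step k)^-1 *
  (`|G| * (r ^+ 2 / 2) + `|G| * (r ^+ 2 / 2))) mD Dy (mphi2 k i)) => y _.
have si : 0 <= (step k)^-1 by rewrite invr_ge0 ltW.
rewrite /phi2 normrM (ger0_norm si) ler_wpM2l//.
by rewrite (le_trans (ler_normB _ _))// lerD.
Qed.

Let integral_phi k i : \int[mu]_(y in D) phi1 k i y = \int[mu]_(y in D) phi2 k i y.
Proof.
have iprod (u : 'rV[R]_n -> R) (C : R) :
    measurable_fun setT (u : 'rV[R]_n -> measurableTypeR R) ->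
    (forall y, `|u y| <= C) -> mu.-integrable D (EFin \o u).
  move=> mu' uC; apply: (@bounded_integrable _ _ _ mu D u C mD Dy (mLeb mu')).
  by move=> y _; exact: uC.
have m1 : measurable_fun setT ((fun y => gt i (y + step k *: delta i) * eta y) :
  'rV[R]_n -> measurableTypeR R).
  exact: (measurable_funM (mshift _ (mgt i)) meta).
have m2 : measurable_fun setT ((fun y => gt i y * eta (y - step k *: delta i)) :
  'rV[R]_n -> measurableTypeR R).
  exact: (measurable_funM (mgt i) (mshift _ meta)).
have m3 : measurable_fun setT ((fun y => gt i y * eta y) : 'rV[R]_n -> measurableTypeR R).
  exact: (measurable_funM (mgt i) meta).
have i1 := iprod _ _ m1 (fun y => prod_le i _ _).
have i2 := iprod _ _ m2 (fun y => prod_le i _ _).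
have i3 := iprod _ _ m3 (fun y => prod_le i _ _).
have i13 : mu.-integrable D (EFin \o (fun y =>
  gt i (y + step k *: delta i) * eta y - gt i y * eta y)).
  have := integrableB mD i1 i3; exact.
have i23 : mu.-integrable D (EFin \o (fun y =>
  gt i y * eta (y - step k *: delta i) - gt i y * eta y)).
  have := integrableB mD i2 i3; exact.
rewrite /phi1 /phi2 (RintegralZl _ mD i13) (RintegralZl _ mD i23); congr (_ * _).
rewrite (RintegralB mD i1 i3) (RintegralB mD i2 i3).
suff -> : \int[mu]_(y in D) (gt i (y + step k *: delta i) * eta y) =
    \int[mu]_(y in D) (gt i y * eta (y - step k *: delta i)) by [].
(* Both products vanish outside [D], one because of [gt] and the other because [eta] lives on [B];
   so both integrals extend to the whole space, where one is a translate of the other. *)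
have s2 y : ~ D y -> gt i y * eta (y - step k *: delta i) = 0.
  by move=> yD; rewrite gt0// mul0r.
have s1 y : ~ D y -> gt i (y + step k *: delta i) * eta y = 0.
  by move=> yD; rewrite eta0 ?mulr0// => /BD.
rewrite (Rintegral_support mu s1) (Rintegral_support mu s2).
have i2T : mu.-integrable setT (EFin \o (fun y => gt i y * eta (y - step k *: delta i))).
  move/(integrable_mkcond _ mD) : i2; congr (integrable _ _ _).
  apply/funext => y; rewrite patchE; case: ifPn => //; rewrite notin_setE => yD.
  by rewrite /= s2.
have [_] := integral_affine (step k *: delta i) ltr01 m2 i2T.
rewrite expr1n invr1 mul1r => <-.
apply: eq_Rintegral => y _; rewrite /affine_rV scale1r addrC; congr (_ * eta _).
by rewrite addrAC subrr add0r.
Qed.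

Let quotient_cvg i y : has_partial i (g i) y ->
  (step k)^-1 * (g i (y + step k *: delta i) - g i y) @[k --> \oo] --> partial i (g i) y.
Proof.
move=> /cvgr_dnbhsP/(_ step); rewrite -/(partial i (g i) y) => cq.
have {}cq := cq (conj (fun k => lt0r_neq0 (step_gt0 k)) step_cvg).
rewrite (_ : (fun k => _) = (fun k => (step k)^-1 *:
    ((g i \o shift y) (step k *: delta i) - g i y))); first exact: cq.
by apply/funext => k; rewrite /= [y + _]addrC.
Qed.

(** The Lipschitz bound dominates the quotients of [g i] by [|L|] on [B], and [gf] identifies the
    limit of their sum almost everywhere. *)
Let cvg_phi1 : (fun k => \int[mu]_(y in D) (\sum_(i < n) phi1 k i y)) @ \oo -->
  \int[mu]_(y in D) (eta y * f y).
Proof.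
apply: (@Rdominated_cvg _ _ _ mu D _ _ (n%:R * (`|L| * (r ^+ 2 / 2))) mD Dy).
- by move=> k; apply: measurable_sum => i; exact: mphi1.
- by apply: measurable_funM => //; exact: mLeb.
- apply: (@filterS _ _ (ae_filter_ringOfSetsType mu) _ _ _ gf) => y + yD => /(_ yD)[dg <-].
  have [yB|yB] := pselect (B y); last first.
    rewrite (eta0 yB) mul0r (_ : (fun k => \sum_(i < n) phi1 k i y) = cst 0).
      exact: cvg_cst.
    apply/funext => k; rewrite big1// => i _.
    by rewrite /phi1 (eta0 yB) !mulr0 subr0 mulr0.
  rewrite mulr_sumr; apply: (@cvg_big R _ +%R 0 predT) => [|i _].
    exact: add_continuous.
  rewrite (_ : (fun k => phi1 k i y) = (fun k => eta y *
    ((step k)^-1 * (g i (y + step k *: delta i) - g i y)))).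
    by apply: cvgMr; exact: quotient_cvg.
  apply/funext => k; rewrite /phi1 !gtE//; first by ring.
  exact: shift_in_D.
- move=> k y yD; rewrite (le_trans (ler_norm_sum _ _ _))//.
  apply: (@le_trans _ _ (\sum_(i < n) (`|L| * (r ^+ 2 / 2)))); last first.
    by rewrite sumr_const card_ord mulr_natl.
  apply: ler_sum => i _.
  have rr : 0 <= r ^+ 2 / 2 by rewrite divr_ge0// sqr_ge0.
  have [yB|yB] := pselect (B y); last first.
    by rewrite /phi1 eta0// !mulr0 subr0 mulr0 normr0 mulr_ge0.
  have zD := shift_in_D k i yB.
  rewrite /phi1 !gtE// -mulrBl mulrA normrM ler_pM//.
  rewrite normrM normfV (gtr0_norm (step_gt0 k)) ler_pdivrMl//.
  have E : enorm (y + step k *: delta i - y) = step k.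
    by rewrite addrAC subrr add0r enormZ enorm_delta mulr1 gtr0_norm.
  rewrite (le_trans (gL i yD _))// E.
    by rewrite (lt_le_trans (step_lt k))// ge_min lexx.
  by rewrite mulrC; apply: ler_wpM2l; [exact: ltW|exact: ler_norm].
Qed.

(** The quotients of [eta] converge off the sphere. As the positive part is 1-Lipschitz, they are
    bounded by [|(y - x)_i| + step k / 2], hence by [e + e] on [D]. *)
Let cvg_phi2 : (fun k => \int[mu]_(y in D) (\sum_(i < n) phi2 k i y)) @ \oo -->
  \int[mu]_(y in D) (((fun y => \sum_(i < n) g i y * (y - x) ord0 i) \_ B) y).
Proof.
apply: (@Rdominated_cvg _ _ _ mu D _ _ (n%:R * (`|G| * (e + e))) mD Dy).
- by move=> k; apply: measurable_sum => i; exact: mphi2.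
- apply/(measurable_restrict _ mB mD).
  rewrite (setIidr BD); apply: (eq_measurable_fun ((fun y =>
    \sum_(i < n) gt i y * (y - x) ord0 i) : lebT R n -> R)).
    by move=> y; rewrite inE => /BD yD; apply: eq_bigr => i _; rewrite gtE.
  apply: (measurable_funS mD BD); apply: mLeb.
  apply: measurable_sum => i; apply: (measurable_funM (mgt i)).
  apply: (eq_measurable_fun (fun y : 'rV[R]_n => y ord0 i - x ord0 i)).
    by move=> y _; rewrite !mxE.
  by apply: measurable_funB => //; exact: measurable_rV_coord.
- apply: (@filterS _ _ (ae_filter_ringOfSetsType mu) _ _ _ (ae_not_sphere x r0)) => y yr yD.
  have T0 : torsion x r y != 0.
    rewrite /torsion mulf_neq0// subr_eq0 eqrXn2 ?enorm_ge0//; last exact: ltW.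
    by rewrite eq_sym.
  have -> : ((fun y => \sum_(i < n) g i y * (y - x) ord0 i) \_ B) y =
      \sum_(i < n) g i y * (if 0 < torsion x r y then (y - x) ord0 i else 0).
    rewrite patchE; case: ifPn => [|] yB.
      rewrite inE in yB; apply: eq_bigr => i _.
      by rewrite lt_neqAle eq_sym T0 torsion_ge0// ltW.
    rewrite notin_setE in yB; rewrite big1// => i _.
    have := eta0 yB; rewrite /eta; case: ltP => //.
      by move=> ? T; rewrite T eqxx in T0.
    by rewrite mulr0.
  apply: (@cvg_big R _ +%R 0 predT) => [|i _]; first exact: add_continuous.
  rewrite (_ : (fun k => phi2 k i y) = (fun k => g i y *
    ((step k)^-1 * (Num.max 0 (torsion x r y +
      (step k * (y - x) ord0 i - step k ^+ 2 / 2)) - Num.max 0 (torsion x r y))))).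
    by apply: cvgMr; exact: max0_quotient_cvg.
  by apply/funext => k; rewrite /phi2 /eta torsion_shift gtE//; ring.
- move=> k y yD; rewrite (le_trans (ler_norm_sum _ _ _))//.
  apply: (@le_trans _ _ (\sum_(i < n) (`|G| * (e + e)))); last first.
    by rewrite sumr_const card_ord mulr_natl.
  apply: ler_sum => i _.
  have h0 := step_gt0 k.
  have he : step k <= e.
    rewrite ltW// (lt_le_trans (step_lt k))// ge_min; apply/orP; right.
    by rewrite gerBl ltW.
  rewrite /phi2 -mulrBr mulrCA normrM ler_pM// normrM normfV (gtr0_norm h0) ler_pdivrMl//.
  rewrite (le_trans (max0_lipschitz _ _))// torsion_shift addrAC subrr add0r.
  rewrite expr2 -mulrA -mulrBr normrM (gtr0_norm h0); apply: ler_wpM2l; first exact: ltW.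
  rewrite (le_trans (ler_normB _ _))// lerD//.
    by rewrite (le_trans (le_coord_enorm _ _))// ltW.
  rewrite ger0_norm; last by apply: divr_ge0; first exact: ltW.
  by move: h0 he; set a := step k => *; lra.
Qed.

(* [eta] is half of [(r^2 - |y - x|^2)_+]. Moving difference quotients from [g i]
   to [eta] uses only the translation invariance of the measure, and passing to
   the limit on both sides only dominated convergence: no surface integral and no
   absolute continuity along lines is involved. *)
Lemma integral_radial_gradient :
  \int[mu]_(y in B) (\sum_(i < n) g i y * (y - x) ord0 i) = torsion_integral x f r.
Proof.
have E : (fun k => \int[mu]_(y in D) (\sum_(i < n) phi1 k i y)) =
    (fun k => \int[mu]_(y in D) (\sum_(i < n) phi2 k i y)).
  apply/funext => k; rewrite (Rintegral_sum mD (iphi1 k)) (Rintegral_sum mD (iphi2 k)).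
  by apply: eq_bigr => i _; exact: integral_phi.
have c1 := cvg_phi1; rewrite E in c1.
have := cvg_unique (@norm_hausdorff _ _) cvg_phi2 c1.
rewrite -Rintegral_mkcondr (setIidr BD) => ->.
rewrite /torsion_integral -/B -[X in _ = Rintegral _ X _](setIidr BD) Rintegral_mkcondr.
apply: eq_Rintegral => y _; rewrite patchE; case: ifPn => yB.
  by move: yB; rewrite inE => /etaE ->.
by move: yB; rewrite notin_setE => /eta0 ->; rewrite mul0r.
Qed.

End weak_identity.

(** * Scaling to the unit ball and differentiation in the radius *)

Section scaling.
Context {R : realType} {n : nat}.
Notation mu := (lebesgue_rV R n).
Implicit Types (x : 'rV[R]_n) (s : R).

Lemma eball0 x s : s <= 0 -> eball x s = set0.
Proof.
move=> s0; rewrite -subset0 => y /= ys.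
by have := lt_le_trans ys s0; rewrite ltNge enorm_ge0.
Qed.

Lemma enorm_line x s (y : 'rV[R]_n) : enorm (x + s *: y - x) = `|s| * enorm y.
Proof. by rewrite addrAC subrr add0r enormZ. Qed.

Lemma integral_unit_ball x s (g : 'rV[R]_n -> R) (C : R) : 0 < s ->
  measurable_fun (eball x s) (g : 'rV[R]_n -> measurableTypeR R) ->
  (forall y, eball x s y -> `|g y| <= C) ->
  \int[mu]_(y in eball 0 1) g (x + s *: y) = s ^- n * \int[mu]_(y in eball x s) g y.
Proof.
move=> s0 mg gC.
pose k : 'rV[R]_n -> R := g \_ (eball x s).
have mk : measurable_fun setT (k : 'rV[R]_n -> measurableTypeR R).
  by apply/(measurable_restrict _ (measurable_eball x s) measurableT); rewrite setTI.
have mgL : measurable_fun (eball x s : set (lebT R n)) g.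
  by apply: measurable_fun_lebesgue; [exact: measurable_eball|exact: mg].
have ik : mu.-integrable setT (EFin \o k).
  rewrite /k -restrict_EFin; apply/(integrable_mkcond _ (measurable_eballT x s)).
  exact: (bounded_integrable (measurable_eballT x s) (lebesgue_eball_lty x s) mgL gC).
have [_ E0] := integral_affine x s0 mk ik.
have -> : \int[mu]_(y in eball x s) g y = \int[mu]_y k y by rewrite Rintegral_mkcond.
rewrite -E0.
rewrite Rintegral_mkcond; apply: eq_Rintegral => y _.
have E : (y \in eball 0 1) = (affine_rV x s y \in eball x s).
  apply/idP/idP; rewrite !inE /eball /= subr0 enorm_line gtr0_norm//.
    by rewrite gtr_pMr.
  by rewrite gtr_pMr.
by rewrite /k !patchE E.
Qed.

End scaling.

Section spherical_average_derivative.
Context {R : realType} {n : nat}.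
Notation mu := (lebesgue_rV R n).
Notation w := (@unit_ball_volume R n).
Variables (Omega : set 'rV[R]_n) (v : 'rV[R]_n -> R) (x : 'rV[R]_n) (e : R).
Hypotheses (oOmega : open Omega) (C1v : C1 Omega v).
Hypothesis eOmega : ceball x e `<=` Omega.

(** The domain is fixed and [s] is any real number, so differentiation under the integral sign also
    works at [s = 0]; the continuity there gives the initial value [v x] of the averages. *)
Definition unit_ball_integral (g : 'rV[R]_n -> R) s :=
  \int[mu]_(y in eball 0 1) g (x + s *: y).

Lemma line_in_eball (s : R) y : `|s| < e -> eball 0 1 y -> eball x e (x + s *: y).
Proof.
rewrite /eball /= subr0 enorm_line => se y1.
by rewrite (le_lt_trans _ se)// ler_piMr// ltW.
Qed.

Lemma measurable_line (g : 'rV[R]_n -> R) (s : R) : continuous_in Omega g -> `|s| < e ->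
  measurable_fun (eball 0 1 : set (lebT R n)) (fun y => g (x + s *: y)).
Proof.
move=> cg se; apply: measurable_fun_lebesgue; first exact: measurable_eball.
apply: measurable_fun_rV_continuous; first exact: open_eball.
move=> y y1; apply: (@continuous_comp _ _ _ (fun y : 'rV[R]_n => x + s *: y) g).
  apply: (@continuousD _ _ _ (cst x) (fun y : 'rV[R]_n => s *: y)).
    exact: cst_continuous.
  exact: scaler_continuous.
by apply: cg; apply/eOmega/sub_eball_ceball; exact: line_in_eball.
Qed.

Lemma is_derive_unit_ball_integral (s : R) : `|s| < e ->
  is_derive s 1 (unit_ball_integral v)
    (\int[mu]_(y in eball 0 1) (\sum_(i < n) y ord0 i * partial i v (x + s *: y))).
Proof.
move=> se.
have [cv pv] := C1v.
have [Mv MvP] := continuous_in_bounded cv (@compact_ceball R n x e) eOmega.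
have /choice[G GP] i := continuous_in_bounded (proj2 (pv i)) (@compact_ceball R n x e) eOmega.
have mB := measurable_eballT (0 : 'rV[R]_n) 1.
have By := lebesgue_eball_lty (0 : 'rV[R]_n) 1.
pose I := `](- e), e[%classic.
have Ie (t : R) : I t -> `|t| < e by rewrite /I /= in_itv/= ltr_norml.
have lineO (t : R) y : I t -> eball 0 1 y -> ceball x e (x + t *: y).
  by move=> /Ie te y1; exact/sub_eball_ceball/line_in_eball.
have dline (t : R) y : I t -> eball 0 1 y -> is_derive t 1 (fun t : R => v (x + t *: y))
    (\sum_(i < n) y ord0 i * partial i v (x + t *: y)).
  move=> It y1.
  have [dv <-] := C1_directional y oOmega (eOmega (lineO t y It y1)) C1v.
  exact: derivable_line.
have Is : I s by rewrite /I /= in_itv/= -ltr_norml.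
have intf (t : R) : I t -> mu.-integrable (eball 0 1) (EFin \o (fun y => v (x + t *: y))).
  move=> It; apply: (@bounded_integrable _ _ _ mu _ _ Mv mB By (measurable_line cv (Ie t It))).
  by move=> y y1; apply: MvP; exact: lineO.
have derf (t : R) y : I t -> eball 0 1 y -> derivable (fun t : R => v (x + t *: y)) t 1.
  by move=> It y1; have [] := dline t y It y1.
(* On the unit ball [|y_i| <= 1], so this constant dominates the derivative of the integrand for
   every admissible parameter. *)
pose C := \sum_(i < n) `|G i|.
have C0 (y : lebT R n) : 0 <= cst C y :> R by exact: sumr_ge0.
have intC : mu.-integrable (eball 0 1 : set (lebT R n)) (EFin \o cst C).
  exact: (@bounded_integrable _ _ _ mu _ _ `|C| mB By).
have partialE (t : R) y : I t -> eball 0 1 y ->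
    partial1of2 (fun (t : R) y => v (x + t *: y)) t y =
    \sum_(i < n) y ord0 i * partial i v (x + t *: y).
  by move=> It y1; rewrite /partial1of2 derive1E; have [] := dline t y It y1.
have Cub (t : R) y : I t -> eball 0 1 y ->
    `|partial1of2 (fun (t : R) y => v (x + t *: y)) t y| <= cst C y.
  move=> It y1; rewrite partialE// (le_trans (ler_norm_sum _ _ _))//.
  apply: ler_sum => i _; rewrite normrM -[leRHS]mul1r ler_pM//.
    by rewrite (le_trans (le_coord_enorm _ _))// -[y]subr0 ltW.
  by rewrite (le_trans (GP i _ (lineO t y It y1)))// ler_norm.
have := cvg_differentiation_under_integral mB Is intf derf C0 intC Cub.
have -> : \int[mu]_(y in eball 0 1) partial1of2 (fun (t : R) y => v (x + t *: y)) s y =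
    \int[mu]_(y in eball 0 1) (\sum_(i < n) y ord0 i * partial i v (x + s *: y)).
  by apply: eq_Rintegral => y; rewrite inE => y1; exact: partialE.
move=> cD.
have cD' : h^-1 *: (unit_ball_integral v (h *: 1 + s) - unit_ball_integral v s) @[h --> 0^']
  --> \int[mu]_(y in eball 0 1) (\sum_(i < n) y ord0 i * partial i v (x + s *: y)).
  rewrite (_ : (fun h => _) = fun h : R =>
    h^-1 *: (unit_ball_integral v (h + s) - unit_ball_integral v s))//.
  by apply/funext => h; rewrite [h *: 1]mulr1.
by apply: DeriveDef; [apply/cvg_ex; eexists; exact: cD'|exact/cvg_lim].
Qed.

End spherical_average_derivative.

(** * The integrand of the mean value formula *)

Section averaged_kernel.
Context {R : realType} {n : nat}.
Notation w := (@unit_ball_volume R n).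
Variables (x : 'rV[R]_n) (e M : R) (f : 'rV[R]_n -> R).
Hypotheses (n0 : (0 < n)%N) (e0 : 0 < e).
Hypothesis mf : measurable_fun (eball x e : set (lebT R n)) f.
Hypothesis fM : forall y, eball x e y -> `|f y| <= M.
Variable eps : R.
Hypotheses (eps0 : 0 < eps) (epse : eps < e).

Let w0 : 0 < w. Proof. exact: unit_ball_volume_gt0. Qed.
Let nR : n%:R != 0 :> R. Proof. by rewrite pnatr_eq0 -lt0n. Qed.
Let wn0 : w != 0. Proof. by rewrite gt_eqF. Qed.
Let M0 : 0 <= M. Proof. exact: ball_bound_ge0 fM e0. Qed.

Lemma sub_invX_itv (s : R) : 0 < s -> s < eps -> 0 <= s ^- n - eps ^- n <= s ^- n.
Proof.
move=> s0 se; rewrite subr_ge0 gerBl; apply/andP; split.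
  rewrite lef_pV2 ?posrE ?exprn_gt0//.
  by apply: lerXn2r; rewrite ?nnegrE; exact: ltW.
by rewrite invr_ge0 exprn_ge0// ltW.
Qed.

(** The product [A_s[f](x) K_eps(s)] expressed through [ball_integral], a form in which continuity
    can be read off. On [[0, eps]] the two agree, also at [s = 0], where both vanish through a
    factor [s]. *)
Definition averaged_kernel (s : R) :=
  ball_integral x f s * (s ^- n - eps ^- n) * (s / (n%:R * w)).

Lemma ball_avg_kernelE s : s \in `[0, eps]%classic ->
  ball_avg s f x * avg_kernel n eps s = averaged_kernel s.
Proof.
rewrite inE/= in_itv/= => /andP[s0 se]; rewrite /averaged_kernel.
have [->|sn0] := eqVneq s 0; first by rewrite /avg_kernel !mul0r !mulr0.
have s1 : 0 < s by rewrite lt_def sn0.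
rewrite /ball_avg fine_lebesgue_eball// /avg_kernel expr_div_n.
rewrite -[Rintegral _ _ _]/(ball_integral x f s).
have sN : s ^+ n != 0 by rewrite expf_neq0.
have eN : eps ^+ n != 0 by rewrite expf_neq0// gt_eqF.
by field; rewrite nR wn0 sN eN.
Qed.

Lemma continuous_averaged_kernel : {within `[0, eps], continuous averaged_kernel}.
Proof.
have kcont (s : R) : 0 < s -> s < e -> {for s, continuous averaged_kernel}.
  move=> s0 se; apply: continuousM.
    apply: continuousM; first exact: (continuous_ball_integral mf fM s0 se).
    apply: continuousB; last exact: cst_continuous.
    by apply: continuousV; [rewrite expf_neq0// gt_eqF|exact: exprn_continuous].
  by apply: continuousM; [exact: cvg_id|exact: cst_continuous].
apply/continuous_within_itvP => //; split.
- by move=> s; rewrite in_itv/= => /andP[s0 se]; apply: kcont => //; exact: lt_trans se _.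
- have -> : averaged_kernel 0 = 0 by rewrite /averaged_kernel !mul0r mulr0.
  apply: norm_cvg0.
  (* The ball integral is at most [M w s^n], which absorbs [s^-n]; the remaining [s / (n w)] leaves
     the majorant [M s / n]. *)
  have cb : M / n%:R * s @[s --> (0:R)^'+] --> 0.
    rewrite -[X in _ --> X](mulr0 (M / n%:R)); apply: cvgMr; exact: cvg_within.
  apply: (@squeeze_cvgr _ _ _ _ (cst 0) _ _ _ _ _ cb); last exact: cvg_cst.
  near=> s; rewrite normr_ge0 /=.
  have s0 : 0 < s by near: s; exact: nbhs_right_gt.
  have se : s < eps by near: s; exact: nbhs_right_lt.
  have /andP[p0 ps] := sub_invX_itv s0 se.
  have snw : 0 <= s / (n%:R * w) by rewrite divr_ge0 ?mulr_ge0// ltW.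
  rewrite /averaged_kernel !normrM (ger0_norm p0) -normrM (ger0_norm snw).
  apply: (@le_trans _ _ (M * (w * s ^+ n) * s ^- n * (s / (n%:R * w)))).
    apply: ler_wpM2r => //; apply: ler_pM => //.
    by apply: (ball_integral_le mf fM) => //; rewrite ltW// (lt_trans se).
  rewrite le_eqVlt; apply/orP; left; apply/eqP; field.
  by rewrite nR wn0 expf_neq0// gt_eqF.
- by apply: cvg_within_filter; exact: kcont.
Unshelve. all: by end_near. Qed.

Lemma integrable_ball_avg_kernel : lebesgue_measure.-integrable `[0, eps]
  (EFin \o (fun r => ball_avg r f x * avg_kernel n eps r)).
Proof.
have := continuous_compact_integrable (@segment_compact R 0 eps) continuous_averaged_kernel.
apply: eq_integrable => // s sI; rewrite /= ball_avg_kernelE//.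
Qed.

End averaged_kernel.

(** * The mean value formula for bounded right-hand sides *)

Section mean_value_expansion.
Context {R : realType} {n : nat}.
Notation mu := (lebesgue_rV R n).
Notation w := (@unit_ball_volume R n).
Variables (Omega : set 'rV[R]_n) (v f : 'rV[R]_n -> R) (x : 'rV[R]_n) (e M : R).
Hypotheses (n0 : (0 < n)%N) (oOmega : open Omega) (C11v : C11 Omega v).
Hypotheses (e0 : 0 < e) (eOmega : ceball x e `<=` Omega).
Hypothesis mf : measurable_fun (eball x e : set (lebT R n)) f.
Hypothesis fM : forall y, eball x e y -> `|f y| <= M.
Hypothesis vf : {ae mu, forall y, eball x e y ->
  (forall i, has_partial i (partial i v) y) /\ laplacian v y = f y}.

Let w0 : 0 < w. Proof. exact: unit_ball_volume_gt0. Qed.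
Let eO y : eball x e y -> Omega y.
Proof. by move=> /sub_eball_ceball/eOmega. Qed.

Let F := ball_integral x f.
Let W := torsion_integral x f.
Let phi (s : R) := w^-1 * unit_ball_integral x v s.

Let integral_gradient s : 0 < s -> s < e ->
  \int[mu]_(y in eball x s) (\sum_(i < n) partial i v y * (y - x) ord0 i) = W s.
Proof.
move=> s0 se; have [[_ pv] lv] := C11v.
have /choice[G GP] i := continuous_in_bounded (proj2 (pv i)) (@compact_ceball R n x e) eOmega.
have /choice[d dP] : forall i, exists d, 0 < d /\ forall y z, ceball x e y ->
    enorm (z - y) < d -> `|partial i v z - partial i v y| <= d^-1 * enorm (z - y).
  move=> i; have [d d0 dP] := locally_lipschitz_compact oOmega (lv i) (@compact_ceball R n x
    e) eOmega.
  by exists d.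
(* Each partial derivative has its own scale [d i] with Lipschitz constant [(d i)^-1]. The sum of
   these constants plus 1 is a common constant, and its inverse is a common scale, below every
   [d i]. *)
have sd0 : 0 < \sum_(i < n) (d i)^-1 + 1.
  by rewrite ltr_wpDl// sumr_ge0// => i _; rewrite invr_ge0 ltW//; have [] := dP i.
have le_sd i : (d i)^-1 <= \sum_(i < n) (d i)^-1 + 1.
  rewrite (bigD1 i)//= -addrA lerDl addr_ge0// sumr_ge0// => j _.
  by rewrite invr_ge0 ltW//; have [] := dP j.
have d0 : 0 < (\sum_(i < n) (d i)^-1 + 1)^-1 by rewrite invr_gt0.
apply: (@integral_radial_gradient R n x e _ (\sum_(i < n) `|G i|)
  (\sum_(i < n) (d i)^-1 + 1) f (fun i => partial i v) mf d0) => //.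
- by move=> i y /eO; have [_] := pv i; exact.
- move=> i y yD; apply: le_trans (GP i y (sub_eball_ceball yD)) _.
  by rewrite (bigD1 i)//= (le_trans (ler_norm _))// lerDl sumr_ge0.
- move=> i y z yD zy; have [di0 diP] := dP i.
  apply: (@le_trans _ _ ((d i)^-1 * enorm (z - y))).
    apply: diP; first exact: sub_eball_ceball.
    apply: (lt_le_trans zy); rewrite -[leRHS]invrK lef_pV2//.
    by rewrite posrE invr_gt0.
  by apply: ler_wpM2r; [exact: enorm_ge0|exact: le_sd].
Qed.

Let measurable_gradient s : s <= e -> measurable_fun (eball x s)
  ((fun y => s^-1 * \sum_(i < n) partial i v y * (y - x) ord0 i) : 'rV[R]_n -> measurableTypeR R).
Proof.
move=> se; have [[_ pv] _] := C11v.
apply: measurable_funM => //; apply: measurable_sum => i; apply: measurable_funM.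
  apply: measurable_fun_rV_continuous; first exact: open_eball.
  by move=> y /(sub_eball se)/eO; have [_] := pv i; exact.
apply: (eq_measurable_fun (fun y : 'rV[R]_n => y ord0 i - x ord0 i)).
  by move=> y _; rewrite !mxE.
by apply: measurable_funB => //; apply: measurable_funTS; exact: measurable_rV_coord.
Qed.

Let is_derive_phi s : 0 < s -> s < e ->
  is_derive s 1 phi (w^-1 * (s ^- n * (s^-1 * W s))).
Proof.
move=> s0 se; have [C1v _] := C11v; have [_ pv] := C1v.
have /choice[G GP] i := continuous_in_bounded (proj2 (pv i)) (@compact_ceball R n x e) eOmega.
have sn : `|s| < e by rewrite gtr0_norm.
have := is_derive_unit_ball_integral oOmega C1v eOmega sn.
(* Return to the ball of radius [s] by [z = x + s y]: the Jacobian gives [s^-n], and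
   [y = (z - x) / s] gives the extra [s^-1]. *)
have -> : \int[mu]_(y in eball 0 1) (\sum_(i < n) y ord0 i * partial i v (x + s *: y)) =
    s ^- n * (s^-1 * W s).
  rewrite -(integral_gradient s0 se).
  have mg := measurable_gradient (ltW se).
  have gB y : eball x s y ->
      `|s^-1 * \sum_(i < n) partial i v y * (y - x) ord0 i| <=
      s^-1 * \sum_(i < n) `|G i| * s.
    move=> ys; rewrite normrM gtr0_norm ?invr_gt0// ler_pM2l ?invr_gt0//.
    rewrite (le_trans (ler_norm_sum _ _ _))//; apply: ler_sum => i _.
    rewrite normrM ler_pM//; last by rewrite (le_trans (le_coord_enorm _ _))// ltW.
    apply: le_trans (GP i y _) (ler_norm _).
    by apply/sub_eball_ceball/(sub_eball (ltW se)).
  have mgL : measurable_fun (eball x s : set (lebT R n))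
      (fun y => \sum_(i < n) partial i v y * (y - x) ord0 i).
    rewrite (_ : (fun y => _) = (fun y => s * (s^-1 *
      \sum_(i < n) partial i v y * (y - x) ord0 i))).
      apply: measurable_funM; first exact: measurable_cst.
      by apply: measurable_fun_lebesgue; [exact: measurable_eball|exact: mg].
    by apply/funext => y; rewrite mulrA divff ?gt_eqF// mul1r.
  have gB' y : eball x s y ->
      `|\sum_(i < n) partial i v y * (y - x) ord0 i| <= \sum_(i < n) `|G i| * s.
    by move=> /gB; rewrite normrM gtr0_norm ?invr_gt0// ler_pM2l ?invr_gt0.
  rewrite -RintegralZl; [|exact: measurable_eballT|]; last first.
    exact: (bounded_integrable (measurable_eballT x s) (lebesgue_eball_lty x s) mgL gB').
  rewrite -(integral_unit_ball s0 mg gB).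
  apply: eq_Rintegral => y _; rewrite mulr_sumr; apply: eq_bigr => i _.
  rewrite [x + _]addrC addrK mxE mulrCA [s * _]mulrC mulrA mulrCA.
  by rewrite divfK ?gt_eqF.
move=> dI; rewrite /phi.
exact: (@is_deriveZ _ _ _ (unit_ball_integral x v) w^-1).
Qed.

Let phi_cont s : 0 <= s -> s < e -> {for s, continuous phi}.
Proof.
move=> s0 se; have [C1v _] := C11v.
have sn : `|s| < e by rewrite ger0_norm.
apply: (@continuousM _ _ (cst w^-1) (unit_ball_integral x v)).
  exact: cst_continuous.
exact: is_derive1_continuous (is_derive_unit_ball_integral oOmega C1v eOmega sn).
Qed.

Let phi0 : phi 0 = v x.
Proof.
rewrite /phi /unit_ball_integral.
rewrite (@eq_Rintegral _ _ _ mu _ (cst (v x))); last first.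
  by move=> y _; rewrite scale0r addr0.
rewrite Rintegral_cst; last exact: measurable_eballT.
by rewrite mulrCA mulVf ?mulr1// gt_eqF.
Qed.

Let phiE s : 0 < s -> s < e -> phi s = ball_avg s v x.
Proof.
move=> s0 se; have [[cv _] _] := C11v.
have [Mv MvP] := continuous_in_bounded cv (@compact_ceball R n x e) eOmega.
rewrite /phi /unit_ball_integral /ball_avg fine_lebesgue_eball// invfM.
rewrite (@integral_unit_ball _ _ x s v Mv s0) ?mulrA//.
  apply: measurable_fun_rV_continuous; first exact: open_eball.
  by move=> y /(sub_eball (ltW se))/eO; exact: cv.
by move=> y /(sub_eball (ltW se))/sub_eball_ceball; exact: MvP.
Qed.

Lemma mean_value_expansion_bounded eps : 0 < eps -> eps < e ->
  ball_avg eps v x - v x =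
  \int[lebesgue_measure]_(r in `[0, eps]) (ball_avg r f x * avg_kernel n eps r).
Proof.
move=> eps0 epse.
have nR : n%:R != 0 :> R by rewrite pnatr_eq0 -lt0n.
have wn0 : w != 0 by rewrite gt_eqF.
have M0 : 0 <= M by exact: ball_bound_ge0 fM e0.
pose k := averaged_kernel x f eps.
(* [H] is an antiderivative of the integrand because
   [phi' = W / (w s^(n+1))] and [W' s = s * F s]. *)
pose H s := phi s + W s * ((s ^- n - eps ^- n) * (n%:R * w)^-1).
rewrite (@eq_Rintegral _ _ _ lebesgue_measure _ k); last first.
  by move=> s; exact: ball_avg_kernelE.
have dH s : 0 < s -> s < e -> is_derive s 1 H (k s).
  move=> s0 se.
  have dW := is_derive_torsion_integral mf fM s0 se.
  have dp := is_derive_phi s0 se.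
  have sN : s ^+ n != 0 by rewrite expf_neq0// gt_eqF.
  have dX : is_derive s 1 (fun t : R => t ^- n) (- (s ^+ n) ^- 2 * (n%:R * s ^+ n.-1)).
    by apply: (@is_deriveV _ (fun t : R => t ^+ n)) => //; exact: is_derive1_exprn.
  have dXC : is_derive s 1 (fun t : R => (t ^- n - eps ^- n) * (n%:R * w)^-1)
      ((- (s ^+ n) ^- 2 * (n%:R * s ^+ n.-1)) * (n%:R * w)^-1).
    have dB := is_deriveB dX (is_derive_cst (eps ^- n) s 1).
    have := is_deriveZ (n%:R * w)^-1 dB; rewrite subr0 [_ *: _]mulrC.
    rewrite (_ : _ \*: _ = fun t : R => (t ^- n - eps ^- n) * (n%:R * w)^-1)//.
    by apply/funext => t; exact: mulrC.
  have := is_deriveD dp (is_deriveM dW dXC).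
  rewrite (_ : phi + _ = H)// => dH; apply: is_derive_eq dH _.
  rewrite /k /averaged_kernel -/(F s) /GRing.scale /= -/(W s) -[X in s ^+ X.-1](prednK n0) /=.
  (* Differentiation produced [s^(n-1)]; [s^n] is expressed through it so that [field] sees a single
     power of unknown exponent. *)
  have -> : s ^+ n = s * s ^+ n.-1 by rewrite -exprS prednK.
  have sP : s ^+ n.-1 != 0 by rewrite expf_neq0// gt_eqF.
  have eN : eps ^+ n != 0 by rewrite expf_neq0// gt_eqF.
  by field; rewrite nR wn0 sP eN gt_eqF.
have Hcont s : 0 < s -> s < e -> {for s, continuous H}.
  by move=> s0 se; exact: is_derive1_continuous (dH s s0 se).
(* The coefficient in [H 0] uses the default [0^-1 = 0], harmlessly since [W 0 = 0]. For the limit,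
   [|W s| <= (s^2 / 2) M w s^n] against [s^-n / (n w)] leaves [M s^2 / (2 n)]. *)
have H0 : H s @[s --> 0^'+] --> H 0.
  have W0 : W 0 = 0 by rewrite /W /torsion_integral eball0// Rintegral_set0.
  apply: cvgD; first by apply: cvg_within_filter; exact: phi_cont.
  rewrite W0 mul0r; apply: norm_cvg0.
  have cb : M / 2 / n%:R * s ^+ 2 @[s --> (0:R)^'+] --> 0.
    rewrite -[X in _ --> X](_ : M / 2 / n%:R * 0 ^+ 2 = 0); last by rewrite expr0n mulr0.
    by apply: cvgMr; apply: cvg_within_filter; exact: exprn_continuous.
  apply: (@squeeze_cvgr _ _ _ _ (cst 0) _ _ _ _ _ cb); last exact: cvg_cst.
  near=> s; rewrite normr_ge0 /=.
  have s0 : 0 < s by near: s; exact: nbhs_right_gt.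
  have se : s < eps by near: s; exact: nbhs_right_lt.
  have /andP[p0 ps] : 0 <= s ^- n - eps ^- n <= s ^- n by exact: sub_invX_itv.
  have nw : 0 <= (n%:R * w)^-1 by rewrite invr_ge0 mulr_ge0// ltW.
  rewrite !normrM (ger0_norm p0) (ger0_norm nw).
  apply: (@le_trans _ _ (s ^+ 2 / 2 * M * (w * s ^+ n) * (s ^- n * (n%:R * w)^-1))).
    apply: ler_pM => //; first by apply: mulr_ge0.
      by apply: (torsion_integral_le mf fM) => //; rewrite ltW// (lt_trans se).
    exact: ler_wpM2r.
  rewrite le_eqVlt; apply/orP; left; apply/eqP; field.
  by rewrite nR wn0 expf_neq0// gt_eqF.
have kC : {within `[0, eps], continuous k} by exact: (continuous_averaged_kernel n0 e0 mf fM
  eps0 epse).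
have HD : derivable_oo_LRcontinuous H 0 eps.
  split => //.
    move=> s; rewrite in_itv/= => /andP[s0 se].
    by have [] := dH s s0 (lt_trans se epse).
  by apply: cvg_within_filter; exact: Hcont.
have Hk : {in `]0, eps[, H^`()%classic =1 k}.
  move=> s; rewrite in_itv/= => /andP[s0 se].
  by rewrite derive1E; have [] := dH s s0 (lt_trans se epse).
rewrite /Rintegral (continuous_FTC2 eps0 kC HD Hk) -EFinB /=.
rewrite /H subrr mul0r mulr0 addr0 phiE//.
have -> : W 0 = 0 by rewrite /W /torsion_integral eball0// Rintegral_set0.
by rewrite mul0r addr0 phi0.
Unshelve. all: by end_near. Qed.

End mean_value_expansion.

(** * The total mass of the kernel *)

Section avg_kernel_integral.
Context {R : realType} (n : nat).
Hypothesis n0 : (0 < n)%N.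
Variable eps : R.
Hypothesis eps0 : 0 < eps.

Let nR : n%:R != 0 :> R. Proof. by rewrite pnatr_eq0 -lt0n. Qed.

Lemma continuous_avg_kernel : continuous (avg_kernel n eps).
Proof.
have -> : avg_kernel n eps =
    (fun r : R => r / n%:R) * (fun r : R => 1 - (r / eps) ^+ n) by exact/funext.
move=> s; apply: continuousM.
  by apply: continuousM; [exact: cvg_id|exact: cst_continuous].
apply: continuousB; first exact: cst_continuous.
apply: (@continuous_comp _ _ _ (fun r : R => r / eps) (fun t => t ^+ n));
  last exact: exprn_continuous.
by apply: continuousM; [exact: cvg_id|exact: cst_continuous].
Qed.

Lemma avg_kernel_ge0 r : 0 <= r -> r <= eps -> 0 <= avg_kernel n eps r.
Proof.
move=> r0 re; apply: mulr_ge0; first by rewrite divr_ge0.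
rewrite subr_ge0 exprn_ile1//; first by rewrite divr_ge0// ltW.
by rewrite ler_pdivrMr// mul1r.
Qed.

Lemma integrable_avg_kernel :
  lebesgue_measure.-integrable `[0, eps] (EFin \o avg_kernel n eps).
Proof.
apply: continuous_compact_integrable; first exact: segment_compact.
exact/continuous_subspaceT/continuous_avg_kernel.
Qed.

Lemma integral_avg_kernel :
  \int[lebesgue_measure]_(r in `[0, eps]) avg_kernel n eps r =
  eps ^+ 2 / (2 * (n%:R + 2)).
Proof.
have n2 : n%:R + 2 != 0 :> R by rewrite -natrD pnatr_eq0 addn2.
(* Termwise antiderivative of [r / n - r^(n+1) / (n eps^n)]; at [eps] it equals
   [eps^2 (1/(2n) - 1/(n(n+2)))], which is the constant of the statement. *)
pose P (r : R) := (2 * n%:R)^-1 * r ^+ 2 - (n%:R * (n%:R + 2) * eps ^+ n)^-1 * r ^+ n.+2.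
have en : eps ^+ n != 0 by rewrite expf_neq0// gt_eqF.
have dP (r : R) : is_derive r 1 P (avg_kernel n eps r).
  have := is_deriveB (is_deriveZ (2 * n%:R)^-1 (is_derive1_exprn 2 r))
    (is_deriveZ (n%:R * (n%:R + 2) * eps ^+ n)^-1 (is_derive1_exprn n.+2 r)).
  move=> d; apply: is_derive_eq d _.
  rewrite /GRing.scale /= /avg_kernel expr_div_n expr1 exprS -[n.+2]addn2 natrD.
  by field; rewrite n2 nR en.
have cP : continuous P.
  by move=> r; exact: is_derive1_continuous (dP r).
have kC : {within `[0, eps], continuous (avg_kernel n eps)}.
  exact/continuous_subspaceT/continuous_avg_kernel.
have PD : derivable_oo_LRcontinuous P 0 eps.
  by split => //; apply: cvg_within_filter; exact: cP.
have Pk : {in `]0, eps[, P^`()%classic =1 avg_kernel n eps}.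
  by move=> r _; rewrite derive1E; exact: derive_val.
rewrite /Rintegral (continuous_FTC2 eps0 kC PD Pk) -EFinB /= /P.
rewrite !exprS expr0 !mul0r !mulr0 !subr0.
by field; rewrite n2 nR en.
Qed.

End avg_kernel_integral.

(** * Locally essentially bounded right-hand sides; expansion and bound of the remainder *)

Section remainder_expansion.
Context {R : realType} {n : nat}.
Notation mu := (lebesgue_rV R n).
Notation w := (@unit_ball_volume R n).
Variables (Omega : set 'rV[R]_n) (f : 'rV[R]_n -> R).
Hypotheses (n0 : (0 < n)%N) (oOmega : open Omega) (hf : Linfty_loc Omega f).
Variables (x : 'rV[R]_n) (eps : R).
Hypotheses (Ox : Omega x) (eps0 : 0 < eps).
Hypothesis eps_dist : (eps%:E < set_dist x (bdry Omega))%E.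

Lemma measurable_fun_sub_eball e : ceball x e `<=` Omega ->
  measurable_fun (eball x e : set (lebT R n)) f.
Proof.
move=> eO; apply: measurable_funS (proj1 hf).
  by apply: measurable_lebesgue_rV; exact: measurable_rV_open.
by move=> y /sub_eball_ceball/eO.
Qed.

(* [f] is only essentially bounded; the truncation [g] is bounded everywhere
   and has the same averages. *)
Lemma truncation : exists (e M : R) (g : 'rV[R]_n -> R),
  [/\ eps < e, ceball x e `<=` Omega,
      measurable_fun (eball x e : set (lebT R n)) g,
      forall y, eball x e y -> `|g y| <= M &
      {ae mu, forall y, eball x e y -> f y = g y}].
Proof.
have [e epse edist] := set_dist_room eps_dist.
have eO := ceball_sub_open oOmega Ox edist.
have [_ /(_ _ (@compact_ceball R n x e) eO) fK] := hf.
have [M MP] : exists M : R, {ae mu, forall y, ceball x e y -> `|f y| <= M}.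
  exists (fine (ess_sup_norm (ceball x e) f)).
  apply: (@filterS _ _ (ae_filter_ringOfSetsType mu) _ _ _
    (ess_sup_ge mu (fun y => (\1_(ceball x e) y * `|f y|)%:E))) => y + ye.
  rewrite indicE mem_set// mul1r -/(ess_sup_norm (ceball x e) f).
  by case: (ess_sup_norm _ _) fK => //= r _; rewrite lee_fin.
have mfe := measurable_fun_sub_eball eO.
exists e, `|M|, (fun y => Num.max (- `|M|) (Num.min `|M| (f y))).
split; [exact: epse|exact: eO| | |].
- exact: (measurable_maxr (measurable_cst _) (measurable_minr (measurable_cst _) mfe)).
- move=> y _; rewrite ler_norml le_max lexx /= ge_max ge_min lexx /= andbT.
  by rewrite lerNl (le_trans _ (normr_ge0 M))// oppr_le0.
- apply: (@filterS _ _ (ae_filter_ringOfSetsType mu) _ _ _ MP) => y + ye.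
  move=> /(_ (sub_eball_ceball ye)) fM.
  have /ler_normlP[fM1 fM2] := le_trans fM (ler_norm M).
  by rewrite min_r// max_r// lerNl.
Qed.

Lemma ae_eq_ball_avg (g h : 'rV[R]_n -> R) e r : r <= e ->
  measurable_fun (eball x e : set (lebT R n)) g ->
  measurable_fun (eball x e : set (lebT R n)) h ->
  {ae mu, forall y, eball x e y -> g y = h y} ->
  ball_avg r g x = ball_avg r h x.
Proof.
move=> re mg mh gh; rewrite /ball_avg; congr (_ * _); rewrite /Rintegral; congr fine.
have me := measurable_eballT x e.
apply: ae_eq_integral; first exact: measurable_eballT.
- by apply/measurable_EFinP; apply: measurable_funS mg => //; exact: sub_eball.
- by apply/measurable_EFinP; apply: measurable_funS mh => //; exact: sub_eball.
- apply: (@filterS _ _ (ae_filter_ringOfSetsType mu) _ _ _ gh) => y + yr.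
  by move=> /(_ (sub_eball re yr)) ->.
Qed.

(** The equation holds almost everywhere, so it survives the replacement of [f] by its truncation,
    and the averages do not see the change. *)
Lemma mean_value_expansion v : C11 Omega v -> poisson_ae Omega v f ->
  ball_avg eps v x - v x =
  \int[lebesgue_measure]_(r in `[0, eps]) (ball_avg r f x * avg_kernel n eps r).
Proof.
move=> C11v vf; have [e [M [g [epse eO mg gM fg]]]] := truncation.
have e0 : 0 < e by exact: lt_trans epse.
have mf := measurable_fun_sub_eball eO.
have vg : {ae mu, forall y, eball x e y ->
    (forall i, has_partial i (partial i v) y) /\ laplacian v y = g y}.
  apply: (@filterS2 _ _ (ae_filter_ringOfSetsType mu) _ _ _ _ vf fg) => y vfy fgy ye.
  have [vp vl] := vfy (eO _ (sub_eball_ceball ye)).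
  by split => //; rewrite vl fgy.
rewrite (mean_value_expansion_bounded n0 oOmega C11v e0 eO mg gM vg eps0 epse).
apply: eq_Rintegral => r; rewrite inE/= in_itv/= => /andP[_ re].
by rewrite (@ae_eq_ball_avg f g e r)// (le_trans re)// ltW.
Qed.

Lemma ball_avgB_cst (g : 'rV[R]_n -> R) (M c r : R) : 0 < r ->
  measurable_fun (eball x r : set (lebT R n)) g ->
  (forall y, eball x r y -> `|g y| <= M) ->
  ball_avg r (fun y => g y - c) x = ball_avg r g x - c.
Proof.
move=> r0 mg gM; rewrite /ball_avg.
have mr := measurable_eballT x r.
have ry := lebesgue_eball_lty x r.
have ig := bounded_integrable mr ry mg gM.
have ic : mu.-integrable (eball x r) (EFin \o (fun=> c)).
  exact: (bounded_integrable (C := `|c|) mr ry (measurable_cst c)).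
rewrite (RintegralB mr ig ic) Rintegral_cst// mulrBr fine_lebesgue_eball//.
rewrite mulrCA mulVf ?mulr1// mulf_neq0// ?expf_neq0// gt_eqF//.
exact: unit_ball_volume_gt0.
Qed.

(** Linearity of the averages, with the mass of the kernel as coefficient of [f x]. Truncation
    replaces [f] under the averages only: the subtracted constant stays [f x], which may differ from
    [g x]. *)
Lemma remainderE : remainder f eps x =
  \int[lebesgue_measure]_(r in `[0, eps]) (ball_avg r f x * avg_kernel n eps r) -
  f x / (2 * (n%:R + 2)) * eps ^+ 2.
Proof.
have [e [M [g [epse eO mg gM fg]]]] := truncation.
have e0 : 0 < e by exact: lt_trans epse.
have mf := measurable_fun_sub_eball eO.
have fgr r : r <= eps -> ball_avg r f x = ball_avg r g x.
  by move=> re; apply: (@ae_eq_ball_avg f g e r) => //; rewrite (le_trans re)// ltW.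
have fgcr r : r <= eps -> ball_avg r (fun y => f y - f x) x = ball_avg r (fun y => g y - f x) x.
  move=> re; apply: (@ae_eq_ball_avg _ _ e r).
  - by rewrite (le_trans re)// ltW.
  - by apply: measurable_funB => //; exact: measurable_cst.
  - by apply: measurable_funB => //; exact: measurable_cst.
  - by apply: (@filterS _ _ (ae_filter_ringOfSetsType mu) _ _ _ fg) => y + ye => ->.
have kI := integrable_avg_kernel n eps.
have kfI : lebesgue_measure.-integrable `[0, eps] (EFin \o (fun r => f x * avg_kernel n eps r)).
  by apply: (integrableZl _ (f x) kI).
have gI := integrable_ball_avg_kernel n0 e0 mg gM eps0 epse.
rewrite (_ : f x / _ * _ = f x * (eps ^+ 2 / (2 * (n%:R + 2)))); last by rewrite mulrAC -mulrA.
rewrite -integral_avg_kernel// -RintegralZl// /remainder.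
have -> : \int[lebesgue_measure]_(r in `[0, eps]) (ball_avg r f x * avg_kernel n eps r) =
    \int[lebesgue_measure]_(r in `[0, eps]) (ball_avg r g x * avg_kernel n eps r).
  by apply: eq_Rintegral => r; rewrite inE/= in_itv/= => /andP[_ re]; rewrite fgr.
rewrite -RintegralB//.
apply: eq_Rintegral => r; rewrite inE/= in_itv/= => /andP[r0 re].
(* At [r = 0] the ball is empty and its average is 0, so a subtracted constant cannot be pulled out;
   the kernel vanishes there. *)
rewrite fgcr//; have [->|rn0] := eqVneq r 0; first by rewrite /avg_kernel !mul0r !mulr0 subrr.
have {}r0 : 0 < r by rewrite lt_def rn0.
have re' : r <= e by rewrite (le_trans re)// ltW.
rewrite (@ball_avgB_cst g M)// ?mulrBl//.
  by apply: measurable_funS mg; [exact: measurable_eballT|exact: sub_eball].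
by move=> y /(sub_eball re'); exact: gM.
Qed.

(** The kernel is nonnegative, so a bound on the oscillation passes to every average and leaves the
    integral with the mass of the kernel. All the error estimates come from this one by a choice of
    [C]. *)
Lemma remainder_le (C : R) : (forall y, eball x eps y -> `|f y - f x| <= C) ->
  `|remainder f eps x| <= C / (2 * (n%:R + 2)) * eps ^+ 2.
Proof.
move=> fC.
have [e [M [g [epse eO mg gM fg]]]] := truncation.
have e0 : 0 < e by exact: lt_trans epse.
have mf := measurable_fun_sub_eball eO.
have mgc : measurable_fun (eball x e : set (lebT R n)) (fun y => g y - f x).
  by apply: measurable_funB => //; exact: measurable_cst.
have mfc : measurable_fun (eball x e : set (lebT R n)) (fun y => f y - f x).
  by apply: measurable_funB => //; exact: measurable_cst.
have gcM y : eball x e y -> `|g y - f x| <= M + `|f x|.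
  by move=> ye; rewrite (le_trans (ler_normB _ _))// lerD2r; exact: gM.
have fgcr r : r <= eps -> ball_avg r (fun y => f y - f x) x = ball_avg r (fun y => g y - f x) x.
  move=> re; apply: (@ae_eq_ball_avg _ _ e r) => //.
  - by rewrite (le_trans re)// ltW.
  - by apply: (@filterS _ _ (ae_filter_ringOfSetsType mu) _ _ _ fg) => y + ye => ->.
have gI := integrable_ball_avg_kernel n0 e0 mgc gcM eps0 epse.
have kI := integrable_avg_kernel n eps.
have CkI : lebesgue_measure.-integrable `[0, eps] (EFin \o (fun r => C * avg_kernel n eps r)).
  by apply: (integrableZl _ C kI).
rewrite (_ : C / _ * _ = C * (eps ^+ 2 / (2 * (n%:R + 2)))); last by rewrite mulrAC -mulrA.
rewrite -integral_avg_kernel// -RintegralZl// /remainder.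
have -> : \int[lebesgue_measure]_(r in `[0, eps])
      (ball_avg r (fun y => f y - f x) x * avg_kernel n eps r) =
    \int[lebesgue_measure]_(r in `[0, eps])
      (ball_avg r (fun y => g y - f x) x * avg_kernel n eps r).
  by apply: eq_Rintegral => r; rewrite inE/= in_itv/= => /andP[_ re]; rewrite fgcr.
apply: le_trans (le_normr_Rintegral _ gI) _ => //.
have gI' : lebesgue_measure.-integrable `[0, eps] (EFin \o (fun r =>
    `|ball_avg r (fun y => g y - f x) x * avg_kernel n eps r|)).
  exact: integrable_norm gI.
apply: (le_Rintegral _ gI' CkI) => // r; rewrite /= in_itv/= => /andP[r0 re].
rewrite normrM (ger0_norm (avg_kernel_ge0 n eps0 r0 re)).
have [->|rn0] := eqVneq r 0; first by rewrite /avg_kernel !mul0r !mulr0.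
apply: ler_wpM2r; first exact: avg_kernel_ge0.
have {}r0 : 0 < r by rewrite lt_def rn0.
have wr0 : 0 < w * r ^+ n by rewrite mulr_gt0 ?exprn_gt0// unit_ball_volume_gt0.
(* The truncation served integrability in [r]; the bound [C] is known for [f], hence the return to
   it. *)
rewrite -fgcr// /ball_avg fine_lebesgue_eball// normrM ger0_norm ?invr_ge0 ?(ltW wr0)//.
rewrite ler_pdivrMl// mulrC -(fine_lebesgue_eball x r0).
apply: (norm_Rintegral_le (measurable_eballT x r) (lebesgue_eball_lty x r)).
- apply: measurable_funS mfc; first exact: measurable_eballT.
  by apply: sub_eball; rewrite (le_trans re)// ltW.
- by move=> y /(sub_eball re); exact: fC.
Qed.

End remainder_expansion.

(** * The formula, the expansion and the error estimates together *)

Theorem theorem2p1 (R : realType) (n : nat) (hn : (2 <= n)%N)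
    (Omega : set 'rV[R]_n) (oOmega : open Omega)
    (v f : 'rV[R]_n -> R)
    (hf : Linfty_loc Omega f) (hv : C11 Omega v)
    (hvf : poisson_ae Omega v f) :
  let admissible eps x := 0 < eps /\ (eps%:E < set_dist x (bdry Omega))%E in
  let expansion eps x :=
    (ball_avg eps v - v) x =
    f x / (2 * (n%:R + 2)) * eps ^+ 2 + remainder f eps x in
  (forall x, Omega x -> forall eps, admissible eps x ->
    (ball_avg eps v - v) x =
    \int[lebesgue_measure]_(r in `[0, eps]) (ball_avg r f x * avg_kernel n eps r))
  /\ {ae lebesgue_rV R n, forall x, Omega x ->
       forall eps, admissible eps x -> expansion eps x}
  /\ (forall x, Omega x -> {for x, continuous f} ->
       (fun eps : R => remainder f eps x) =o_ (0^'+) (fun eps : R => eps ^+ 2))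
  /\ (continuous_in Omega f ->
       (forall x, Omega x -> forall eps, admissible eps x -> expansion eps x)
       /\ locally_uniformly_littleo Omega 2 (remainder f))
  /\ (forall w : R -> R, modulus_of_continuity w ->
       (forall x y, Omega x -> Omega y -> `|f x - f y| <= w (enorm (x - y))) ->
       forall x, Omega x -> forall eps, admissible eps x ->
         `|remainder f eps x| <= 1 / (2 * (n%:R + 2)) * w eps * eps ^+ 2)
  /\ (forall alpha : R, 0 < alpha -> alpha <= 1 ->
       (exists L : R, forall x y, Omega x -> Omega y ->
         `|f x - f y| <= L * enorm (x - y) `^ alpha) ->
       exists C : R, forall x, Omega x -> forall eps, admissible eps x ->
         `|remainder f eps x| <= C * eps `^ (2 + alpha)).
Proof.
have n0 : (0 < n)%N by exact: leq_trans hn.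
have n2 : 0 < 2 * (n%:R + 2) :> R by rewrite mulr_gt0// ltr_wpDl.
have n2' : (2 * (n%:R + 2))^-1 <= 1 :> R.
  by rewrite invf_le1//; have : 0 <= n%:R :> R by []; lra.
move=> admissible expansion.
have main x : Omega x -> forall eps, admissible eps x ->
    (ball_avg eps v - v) x =
    \int[lebesgue_measure]_(r in `[0, eps]) (ball_avg r f x * avg_kernel n eps r).
  by move=> Ox eps [eps0 ed]; exact: (mean_value_expansion n0 oOmega hf Ox eps0 ed hv hvf).
have expand x : Omega x -> forall eps, admissible eps x -> expansion eps x.
  move=> Ox eps adm; rewrite /expansion (main x Ox eps adm).
  by have [eps0 ed] := adm; rewrite (remainderE n0 oOmega hf Ox eps0 ed) addrC subrK.
have bound x : Omega x -> forall eps, admissible eps x -> forall C,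
    (forall y, eball x eps y -> `|f y - f x| <= C) ->
    `|remainder f eps x| <= C / (2 * (n%:R + 2)) * eps ^+ 2.
  by move=> Ox eps [eps0 ed] C; exact: (remainder_le n0 oOmega hf Ox eps0 ed).
(* Common core of both little-o claims: a ball of radius [d > eps] inside [Omega] makes [eps]
   admissible, and oscillation at most [eta] on it gives [eta eps^2], as [1 / (2 (n + 2)) <= 1]. *)
have small x d eta eps : Omega x -> 0 < eps -> eps < d -> 0 <= eta ->
    (forall y, eball x d y -> Omega y /\ `|f y - f x| <= eta) ->
    `|remainder f eps x| <= eta * eps ^+ 2.
  move=> Ox eps0 epsd eta0 H.
  have adm : admissible eps x.
    split => //; apply: (lt_set_dist_bdry (d := d)) => // y /H[].
    by [].
  apply: (le_trans (bound x Ox eps adm eta _)).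
    by move=> y /(sub_eball (ltW epsd))/H[].
  by rewrite ler_wpM2r ?sqr_ge0// ler_piMr.
have inO x eps y : Omega x -> admissible eps x -> eball x eps y -> Omega y.
  by move=> Ox [_ ed] /sub_eball_ceball; exact: ceball_sub_open.
split; [exact: main|split; [exact: aeW|split; [|split; [|split]]]].
- move=> x Ox cf; apply/eqoP => eta eta0.
  have /rV_nbhs_box[d d0 dP] : nbhs x (Omega `&` [set y | `|f x - f y| < eta]).
    apply: filterI; first exact: open_nbhs_nbhs.
    by move/cvgrPdist_lt : cf => /(_ eta eta0).
  near=> eps.
  rewrite [X in _ <= _ * X]ger0_norm ?sqr_ge0//.
  apply: (small x d) => //.
  + exact: ltW.
  + move=> y yd; have [i|Oy /= fy] := dP y.
      rewrite distrC; apply: le_lt_trans yd.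
      by have := le_coord_enorm (y - x) i; rewrite !mxE.
    by split => //; rewrite distrC ltW.
- move=> cf; split; first exact: expand.
  move=> K cK KO eta eta0.
  have [d d0 dP] := continuous_in_compact oOmega cf cK KO eta0.
  exists d => // eps eps0 epsd; apply/ess_supP; apply: aeW => x; rewrite lee_fin.
  rewrite indicE; have [xK|xK] := boolP (x \in K); last first.
    by rewrite mul0r mulr_ge0 ?sqr_ge0// ltW.
  rewrite mul1r; rewrite inE in xK; apply: (small x d) => //.
  + exact: KO.
  + exact: ltW.
  + by move=> y yd; exact: dP.
- move=> w [w0 wmono _] fw x Ox eps adm; have [eps0 _] := adm.
  rewrite mul1r [_^-1 * _]mulrC; apply: bound => // y yx.
  rewrite distrC (le_trans (fw _ _ Ox (inO _ _ _ Ox adm yx)))//.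
  by rewrite enorm_distC; apply: wmono; [exact: enorm_ge0|exact: ltW].
(* The oscillation on the ball is at most [|L| eps^alpha]; the absolute value is there because no
   sign is prescribed for [L]. *)
- move=> alpha alpha0 _ [L fL]; exists (`|L| / (2 * (n%:R + 2))).
  move=> x Ox eps adm; have [eps0 _] := adm.
  have -> : eps `^ (2 + alpha) = eps `^ alpha * eps ^+ 2.
    rewrite powRD; last by apply/implyP => _; rewrite gt_eqF.
    by rewrite mulrC powR_mulrn// ltW.
  rewrite mulrA [_ / _ * _]mulrAC; apply: bound => // y yx.
  rewrite distrC (le_trans (fL _ _ Ox (inO _ _ _ Ox adm yx)))//.
  apply: (le_trans (ler_wpM2r (powR_ge0 _ _) (ler_norm L))); apply: ler_wpM2l => //.
  rewrite enorm_distC ge0_ler_powR// ?nnegrE ?enorm_ge0//.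
  - exact: ltW.
  - exact: ltW.
  - exact: ltW.
Unshelve. all: by end_near. Qed.
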